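(* Let $\mathbb{A}$ be an abelian group and let $(\mathcal{E},T,G)$ be an ($\mathbb{A}$-)graded Frobenius cluster category, with $T=\bigoplus_{i=1}^nT_i$. Write $G=\sum_{i=1}^n[S_i]\otimes G_i$ with $G_i\in\mathbb{A}$. (i) Let $\mathbb{C}[x_1^{\pm1},\dots,x_n^{\pm1}]$ be graded by giving $x_i$ degree $G_i$. Then for all $X\in\mathcal{E}$, the cluster character $C^T_X\in\mathbb{C}[x_1^{\pm1},\dots,x_n^{\pm1}]$ is homogeneous of degree $\deg_G(X)$. (ii) For any exact sequence $0\to X\to Y\to Z\to0$ in $\mathcal{E}$, we have $\deg_G(Y)=\deg_G(X)+\deg_G(Z)$. (iii) The degree $\deg_G$ is compatible with mutation, in the sense that for every cluster-tilting object $U$ of $\mathcal{E}$ with non-projective indecomposable summand $U_k$ we have $$\deg_G(U_k^* )=\deg_G(M)-\deg_G(U_k)=\deg_G(M')-\deg_G(U_k),$$ where $0\to U_k^*\to M\to U_k\to0$ and $0\to U_k\to M'\to U_k^*\to0$ are the exchange sequences associated to $U_k$. In particular $\deg_G(M)=\deg_G(M')$.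
   Context: All categories and algebras are over $\mathbb{C}$; all modules are left modules. A Frobenius category is an exact category with enough projectives and enough injectives in which these two classes of objects coincide; its stable category $\underline{\mathcal{E}}$ is the quotient by the morphisms factoring through projective-injective objects, a triangulated category. $\mathcal{E}$ is stably 2-Calabi--Yau if $\underline{\mathcal{E}}$ is Hom-finite and there is a functorial duality $\mathrm{D}\operatorname{Ext}^1_{\mathcal{E}}(X,Y)=\operatorname{Ext}^1_{\mathcal{E}}(Y,X)$ for all $X,Y$. An object $T$ is cluster-tilting if $\operatorname{add}T=\{X\in\mathcal{E}:\operatorname{Ext}^1_{\mathcal{E}}(T,X)=0\}$. A Frobenius cluster category is a Frobenius category that is Krull--Schmidt, stably 2-Calabi--Yau, has at least one cluster-tilting object, and satisfies $\operatorname{gldim}(\operatorname{End}_{\mathcal{E}}(T)^{\mathrm{op}})\le 3$ for all cluster-tilting objects $T$. Let $T=\bigoplus_{i=1}^nT_i$ be a basic cluster-tilting object ($T_i$ indecomposable, pairwise non-isomorphic, projective-injective if and only if $i>r$), with $\Lambda=\operatorname{End}_{\mathcal{E}}(T)^{\mathrm{op}}$ Noetherian. Let $\underline{\Lambda}=\operatorname{End}_{\underline{\mathcal{E}}}(T)^{\mathrm{op}}$, a finite dimensional quotient of $\Lambda$; $\operatorname{mod}$ and $\operatorname{fd}$ denote finitely generated and finite dimensional modules. Put $F=\operatorname{Hom}_{\mathcal{E}}(T,-)\colon\mathcal{E}\to\operatorname{mod}\Lambda$ and $E=\operatorname{Ext}^1_{\mathcal{E}}(T,-)\colon\mathcal{E}\to\operatorname{mod}\underline{\Lambda}$;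 $P_i=FT_i$ are the indecomposable projective $\Lambda$-modules and $S_i=P_i/\operatorname{rad}P_i$ the simple $\Lambda$-modules, whose classes form a basis of $\mathrm{K}_0(\operatorname{fd}\Lambda)$. The Euler form is $\langle M,N\rangle_e=\sum_{i\ge0}(-1)^i\dim\operatorname{Ext}^i_\Lambda(M,N)$, a bilinear map $\mathrm{K}_0(\operatorname{mod}\Lambda)\times\mathrm{K}_0(\operatorname{fd}\Lambda)\to\mathbb{Z}$, extended to $\mathrm{K}_0(\operatorname{mod}\Lambda)\times(\mathrm{K}_0(\operatorname{fd}\Lambda)\otimes_{\mathbb{Z}}\mathbb{A})\to\mathbb{A}$ by $\langle x,\sum y_i\otimes a_i\rangle_e=\sum\langle x,y_i\rangle_ea_i$. A grading for $\mathcal{E}$ is an element $G\in\mathrm{K}_0(\operatorname{fd}\Lambda)\otimes_{\mathbb{Z}}\mathbb{A}$ with $\langle M,G\rangle_e=0$ for all $M\in\operatorname{mod}\underline{\Lambda}$; then $(\mathcal{E},T,G)$ is called a graded Frobenius cluster category, and $\deg_G(X)=\langle FX,G\rangle_e\in\mathbb{A}$ for $X\in\mathcal{E}$. The cluster character of $X\in\mathcal{E}$ is $$C^T_X=\prod_{i=1}^nx_i^{\langle FX,S_i\rangle_e}\sum_{v\in\mathbb{Z}^r}\chi(\mathrm{Gr}_v(EX))\prod_{i=1}^nx_i^{-\langle v,S_i\rangle_e},$$ where $\mathrm{Gr}_v(EX)$ is the projective variety of submodules of $EX$ of dimension vector $v$, $\chi$ is the Euler characteristic, and $\langle v,S_i\rangle_e:=\langle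 M,S_i\rangle_e$ for any $M\in\operatorname{mod}\underline{\Lambda}$ of dimension vector $v$ (this depends only on $v$). Exchange sequences: for a (basic) cluster-tilting object $U$ and non-projective indecomposable summand $U_k$, these are non-split exact sequences $0\to U_k^*\to M\to U_k\to0$ and $0\to U_k\to M'\to U_k^*\to0$ in $\mathcal{E}$ with $M,M'\in\operatorname{add}U$, lifting the exchange triangles of $U_k$ in $\underline{\mathcal{E}}$, which glue to an Auslander--Reiten 4-angle $U_k\to M'\to M\to U_k$. *)

(* Defs.v *)
From HB Require Import structures.
From mathcomp Require Import all_boot all_order all_algebra.
From mathcomp Require mpoly.
(* The notations of mpoly are incompatible with those of MathComp-Analysis. *)
Import -(notations) mpoly.
From mathcomp Require Import complex.
From mathcomp Require Import all_classical all_reals topology normedtype.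

Set Implicit Arguments.
Unset Strict Implicit.
Unset Printing Implicit Defensive.

Import Order.TTheory GRing.Theory Num.Theory.
Import numFieldNormedType.Exports.
Local Open Scope classical_set_scope.
Local Open Scope ring_scope.

(* MathComp's [algType] requires 1 != 0; the zero algebra is allowed here,
   because it is the endomorphism algebra of a zero object. *)
HB.mixin Record PzRing_isPzAlgebra (K : fieldType) A of GRing.PzRing A := {
  algmap : {rmorphism K -> A};
  algmapC : forall (k : K) (a : A), algmap k * a = a * algmap k
}.
#[short(type="pzAlgType")]
HB.structure Definition PzAlgebra (K : fieldType) :=
  {A of GRing.PzRing A & PzRing_isPzAlgebra K A}.

(* M as a vector space over the ground field. *)
Definition restr (K : fieldType) (A : pzAlgType K) (M : lmodType A) : Type := M.

Section Restr.
Variables (K : fieldType) (A : pzAlgType K) (M : lmodType A).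
HB.instance Definition _ := GRing.Zmodule.on (restr M).
Let rscale (k : K) (m : restr M) : restr M := (algmap k : A) *: (m : M).
Fact restr_scalerA k l m : rscale k (rscale l m) = rscale (k * l) m.
Proof. by rewrite /rscale scalerA -rmorphM. Qed.
Fact restr_scale1r : left_id 1 rscale.
Proof. by move=> m; rewrite /rscale rmorph1 scale1r. Qed.
Fact restr_scalerDr : right_distributive rscale +%R.
Proof. by move=> k m p; rewrite /rscale scalerDr. Qed.
Fact restr_scalerDl m : {morph rscale^~ m : k l / k + l}.
Proof. by move=> k l; rewrite /rscale rmorphD scalerDl. Qed.
HB.instance Definition _ := GRing.Zmodule_isLmodule.Build K (restr M)
  restr_scalerA restr_scale1r restr_scalerDr restr_scalerDl.
End Restr.

(* [vdim Z B d]: the subquotient Z / B of V has dimension d. *)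
Definition vdim (K : fieldType) (V : lmodType K) (Z B : set V) (d : nat) : Prop :=
  exists b : 'I_d -> V, (forall i, Z (b i)) /\
    forall z, Z z -> exists! c : 'rV[K]_d, B (z - \sum_i c 0 i *: b i).

Definition quotdim (K : fieldType) (V : lmodType K) (Z B : set V) : nat :=
  xget 0%N [set d | vdim Z B d].

Definition findim (K : fieldType) (V : lmodType K) : Prop :=
  exists d, vdim [set: V] [set 0] d.

Definition is_submod (A : pzRingType) (M : lmodType A) (N : set M) : Prop :=
  [/\ N 0, forall x y, N x -> N y -> N (x + y)
    & forall (a : A) x, N x -> N (a *: x)].

Record submod (A : pzRingType) (M : lmodType A) := Submod {
  smcar :> set M;
  smP : is_submod smcar
}.

Section QuotientModule.
Variables (A : pzRingType) (M : lmodType A) (N : submod M).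

Definition smpred (x : M) : bool := `[< smcar N x >].

Fact smpred_zmod : zmod_closed smpred.
Proof.
case: (smP N) => N0 ND NZ; split; first exact/asboolP.
move=> x y /asboolP Nx /asboolP Ny; apply/asboolP.
by apply: ND => //; rewrite -scaleN1r; apply: NZ.
Qed.
Definition smclosed : zmodClosed M :=
  HB.pack smpred (GRing.isZmodClosed.Build M smpred smpred_zmod).

Definition quotmod : Type := Quotient.quot smclosed.
HB.instance Definition _ := GRing.Zmodule.on quotmod.

Definition qpi (x : M) : quotmod := (\pi_(Quotient.quot smclosed) x)%qT.
Let qrep (q : quotmod) : M := repr (q : Quotient.quot smclosed).

Fact qpi_eq x y : (qpi x = qpi y) <-> smcar N (x - y).
Proof.
rewrite /qpi; split=> [/eqP|Nxy].
  by rewrite -Quotient.idealrBE => /asboolP.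
by apply/eqP; rewrite -Quotient.idealrBE; apply/asboolP.
Qed.
Let qpiD x y : qpi (x + y) = qpi x + qpi y.
Proof. by rewrite /qpi; rewrite [LHS]Quotient.pi_add. Qed.
Let qrepK q : qpi (qrep q) = q.
Proof. exact: reprK. Qed.

Let qscale (a : A) (q : quotmod) : quotmod := qpi (a *: qrep q).
Fact qpiZ a x : qpi (a *: x) = qscale a (qpi x).
Proof.
apply/qpi_eq; rewrite -scalerBr; case: (smP N) => _ _; apply.
by apply/qpi_eq; rewrite qrepK.
Qed.
Fact quotmod_scalerA a b q : qscale a (qscale b q) = qscale (a * b) q.
Proof. by rewrite -[q]qrepK -!qpiZ scalerA. Qed.
Fact quotmod_scale1r : left_id 1 qscale.
Proof. by move=> q; rewrite -[q]qrepK -qpiZ scale1r. Qed.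
Fact quotmod_scalerDr : right_distributive qscale +%R.
Proof.
by move=> a q s; rewrite -[q]qrepK -[s]qrepK -qpiD -!qpiZ scalerDr qpiD.
Qed.
Fact quotmod_scalerDl q : {morph qscale^~ q : a b / a + b}.
Proof. by move=> a b; rewrite -[q]qrepK -!qpiZ scalerDl qpiD. Qed.
HB.instance Definition _ := GRing.Zmodule_isLmodule.Build A quotmod
  quotmod_scalerA quotmod_scale1r quotmod_scalerDr quotmod_scalerDl.
End QuotientModule.

Section Modules.
Variables (A : pzRingType) (M : lmodType A).

Definition fgen (N : set M) : Prop :=
  exists (m : nat) (x : 'I_m -> M),
    N = [set y | exists a : 'I_m -> A, y = \sum_i a i *: x i].

Definition maximal_submod (N : submod M) : Prop :=
  (exists x, ~ smcar N x) /\
  forall N' : submod M, N `<=` N' -> (exists x, ~ smcar N' x) -> N' `<=` N.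

Definition radset : set M := [set x | forall N, maximal_submod N -> smcar N x].
Fact rad_is_submod : is_submod radset.
Proof.
split=> [N _|x y Rx Ry N mN|a x Rx N mN]; case: (smP N) => N0 ND NZ //.
  by apply: ND; [apply: Rx | apply: Ry].
by apply: NZ; apply: Rx.
Qed.
Definition rad : submod M := Submod rad_is_submod.

End Modules.

(* Two-sided: left ideals, and right ideals as left ideals of the converse. *)
Definition noetherian (A : pzRingType) : Prop :=
  (forall I : submod A^o, fgen I) /\ (forall I : submod (A^c)^o, fgen I).

Definition mod_ses (A : pzRingType) (L M N : lmodType A)
    (f : {linear L -> M}) (g : {linear M -> N}) : Prop :=
  [/\ injective f, forall z, exists y, g y = z
    & forall y, g y = 0 <-> exists x, f x = y].

Definition projmod (A : pzRingType) (P : lmodType A) : Prop :=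
  forall (U V : lmodType A) (g : {linear U -> V}) (f : {linear P -> V}),
    (forall v, exists u, g u = v) ->
    exists h : {linear P -> U}, forall x, g (h x) = f x.

Record projres (A : pzRingType) (M : lmodType A) := Projres {
  prP : nat -> lmodType A;
  prd : forall i, {linear prP i.+1 -> prP i};
  pre : {linear prP 0%N -> M};
  pr_proj : forall i, projmod (prP i);
  pr_surj : forall m, exists x, pre x = m;
  pr_exact0 : forall x, pre x = 0 <-> exists y, prd 0%N y = x;
  pr_exactS : forall i x, prd i x = 0 <-> exists y, prd i.+1 y = x
}.

Definition gldim_le (A : pzRingType) (d : nat) : Prop :=
  forall M : lmodType A, exists P : projres M,
    forall i, (d < i)%N -> forall x : prP P i, x = 0.

Section EulerForm.
Variables (K : fieldType) (A : pzAlgType K).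

Section Cochains.
Variables (M N : lmodType A) (P : projres M).

Definition ext_cocycle (i : nat) : set (prP P i -> restr N) :=
  [set f | exists g : {linear prP P i -> N},
     (forall x, f x = g x) /\ (forall y, g (prd P i y) = 0)].

Definition ext_cobound (i : nat) : set (prP P i -> restr N) :=
  match i with
  | 0%N => [set f | forall x, f x = 0]
  | j.+1 => [set f | exists g : {linear prP P j -> N},
                       forall x, f x = g (prd P j x)]
  end.
End Cochains.
Arguments ext_cocycle {M} N P i _.
Arguments ext_cobound {M} N P i _.

(* The dimension of Ext^i_A(M, N), computed from any projective resolution of
   M (0 by convention if it is infinite). *)
Definition extdim (i : nat) (M N : lmodType A) : nat :=
  xget 0%N [set d | exists P : projres M,
                      vdim (ext_cocycle N P i) (ext_cobound N P i) d].

Definition euler (M N : lmodType A) : int :=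
  \sum_(i \in [set: nat]) (-1) ^+ i * (extdim i M N)%:Z.

Record fdmod := FDMod { fdcar :> lmodType A; fdP : findim (restr fdcar) }.

(* The elements of K_0(fd A) (x) Ab are represented by formal sums of symbols
   [N] (x) a, with N finite dimensional.  Two formal sums are equal in the
   tensor product when they agree under every function that is additive on
   short exact sequences in N and additive in a. *)
Definition K0sum (Ab : zmodType) := seq (fdmod * Ab).

Definition K0additive (Ab B : zmodType) (phi : fdmod -> Ab -> B) : Prop :=
  (forall N a b, phi N (a + b) = phi N a + phi N b) /\
  (forall (L M N : fdmod) (f : {linear L -> M}) (g : {linear M -> N}),
     mod_ses f g -> forall a, phi M a = phi L a + phi N a).

Definition K0eq (Ab : zmodType) (s t : K0sum Ab) : Prop :=
  forall (B : zmodType) (phi : fdmod -> Ab -> B), K0additive phi ->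
    \sum_(x <- s) phi x.1 x.2 = \sum_(x <- t) phi x.1 x.2.

Definition eulerK0 (Ab : zmodType) (M : lmodType A) (s : K0sum Ab) : Ab :=
  \sum_(x <- s) x.2 *~ euler M x.1.

End EulerForm.

Record linCat (K : fieldType) := LinCat {
  obj :> Type;
  Mor : obj -> obj -> lmodType K;
  Idm : forall X, Mor X X;
  ccomp : forall X Y Z, Mor Y Z -> Mor X Y -> Mor X Z;
  compA : forall W X Y Z (h : Mor Y Z) (g : Mor X Y) (f : Mor W X),
    ccomp h (ccomp g f) = ccomp (ccomp h g) f;
  comp1m : forall X Y (f : Mor X Y), ccomp (Idm Y) f = f;
  compm1 : forall X Y (f : Mor X Y), ccomp f (Idm X) = f;
  comp_linl : forall X Y Z (k : K) (g g' : Mor Y Z) (f : Mor X Y),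
    ccomp (k *: g + g') f = k *: ccomp g f + ccomp g' f;
  comp_linr : forall X Y Z (k : K) (g : Mor Y Z) (f f' : Mor X Y),
    ccomp g (k *: f + f') = k *: ccomp g f + ccomp g f'
}.
Arguments Mor {K l}.
Arguments Idm {K l}.
Arguments ccomp {K l X Y Z}.
Notation "g '∘' f" := (ccomp g f) (at level 40, left associativity).

Section LinearCategory.
Variables (K : fieldType) (E : linCat K).
Implicit Types X Y Z W : E.

Definition iso X Y (f : Mor X Y) : Prop :=
  exists g : Mor Y X, g ∘ f = Idm X /\ f ∘ g = Idm Y.
Definition isomorphic X Y : Prop := exists f : Mor X Y, iso f.

Definition is_dsum (I : finType) (Xs : I -> E) X
    (inj : forall i, Mor (Xs i) X) (prj : forall i, Mor X (Xs i)) : Prop :=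
  [/\ forall i, prj i ∘ inj i = Idm (Xs i),
      forall i j, i != j -> prj j ∘ inj i = 0
    & \sum_i inj i ∘ prj i = Idm X].
Definition dsum (I : finType) (Xs : I -> E) X : Prop :=
  exists inj prj, @is_dsum I Xs X inj prj.
Definition dsum2 X Y Z : Prop := dsum (fun b : bool => if b then X else Y) Z.

Definition zero_obj X : Prop := Idm X = 0.
Definition indecomposable X : Prop :=
  ~ zero_obj X /\ forall Y Z, dsum2 Y Z X -> zero_obj Y \/ zero_obj Z.
Definition local_end X : Prop :=
  ~ zero_obj X /\ forall f : Mor X X, iso f \/ iso (Idm X - f).
Definition krull_schmidt : Prop :=
  forall X, exists (m : nat) (Xs : 'I_m -> E),
    dsum Xs X /\ forall i, local_end (Xs i).

(* [in_add T X]: X is a direct summand of a finite direct sum of copies of T. *)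
Definition in_add (T X : E) : Prop :=
  exists (m : nat) (X' Y : E), dsum (fun _ : 'I_m => T) Y /\ dsum2 X X' Y.

Definition is_kernel X Y Z (f : Mor X Y) (g : Mor Y Z) : Prop :=
  g ∘ f = 0 /\ forall W (h : Mor W Y), g ∘ h = 0 -> exists! k, f ∘ k = h.
Definition is_cokernel X Y Z (f : Mor X Y) (g : Mor Y Z) : Prop :=
  g ∘ f = 0 /\ forall W (h : Mor Y W), h ∘ f = 0 -> exists! k, k ∘ g = h.
Definition is_pushout W X Y Z (f : Mor W X) (g : Mor W Y)
    (g' : Mor X Z) (f' : Mor Y Z) : Prop :=
  g' ∘ f = f' ∘ g /\
  forall V (a : Mor X V) (b : Mor Y V), a ∘ f = b ∘ g ->
    exists! k, k ∘ g' = a /\ k ∘ f' = b.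
Definition is_pullback W X Y Z (f' : Mor W X) (g' : Mor W Y)
    (g : Mor X Z) (f : Mor Y Z) : Prop :=
  g ∘ f' = f ∘ g' /\
  forall V (a : Mor V X) (b : Mor V Y), g ∘ a = f ∘ b ->
    exists! k, f' ∘ k = a /\ g' ∘ k = b.

(* Quillen's axioms for a class of conflations, in Bühler's formulation. *)
Section ExactStructure.
Variable confl : forall X Y Z, Mor X Y -> Mor Y Z -> Prop.
Definition inflation X Y (f : Mor X Y) : Prop :=
  exists Z (g : Mor Y Z), confl f g.
Definition deflation Y Z (g : Mor Y Z) : Prop :=
  exists X (f : Mor X Y), confl f g.
Record exact_axioms : Prop := {
  confl_kernel : forall X Y Z (f : Mor X Y) (g : Mor Y Z),
    confl f g -> is_kernel f g;
  confl_cokernel : forall X Y Z (f : Mor X Y) (g : Mor Y Z),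
    confl f g -> is_cokernel f g;
  confl_iso : forall X Y Z X' Y' Z' (f : Mor X Y) (g : Mor Y Z)
    (f' : Mor X' Y') (g' : Mor Y' Z') (a : Mor X X') (b : Mor Y Y')
    (c : Mor Z Z'), iso a -> iso b -> iso c ->
    f' ∘ a = b ∘ f -> g' ∘ b = c ∘ g -> confl f g -> confl f' g';
  inflation_id : forall X, inflation (Idm X);
  deflation_id : forall X, deflation (Idm X);
  inflation_comp : forall X Y Z (f : Mor X Y) (g : Mor Y Z),
    inflation f -> inflation g -> inflation (g ∘ f);
  deflation_comp : forall X Y Z (f : Mor X Y) (g : Mor Y Z),
    deflation f -> deflation g -> deflation (g ∘ f);
  inflation_pushout : forall W X Y (f : Mor W X) (g : Mor W Y),
    inflation f -> exists Z (g' : Mor X Z) (f' : Mor Y Z),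
      is_pushout f g g' f' /\ inflation f';
  deflation_pullback : forall X Y Z (g : Mor X Z) (f : Mor Y Z),
    deflation g -> exists W (f' : Mor W X) (g' : Mor W Y),
      is_pullback f' g' g f /\ deflation g'
}.
End ExactStructure.

(* The ring End_E(X)^op, acting from the left on Hom_E(X, Y). *)
Definition Endop X : Type := Mor X X.

Section Endop.
Variable X : E.
HB.instance Definition _ := GRing.Zmodule.copy (Endop X) (Mor X X).
Let mul (a b : Endop X) : Endop X := (b : Mor X X) ∘ (a : Mor X X).

Let compDl Y1 Y2 Y3 (g g' : Mor Y2 Y3) (f : Mor Y1 Y2) :
  (g + g') ∘ f = g ∘ f + g' ∘ f.
Proof. by have := comp_linl 1 g g' f; rewrite !scale1r. Qed.
Let compDr Y1 Y2 Y3 (g : Mor Y2 Y3) (f f' : Mor Y1 Y2) :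
  g ∘ (f + f') = g ∘ f + g ∘ f'.
Proof. by have := comp_linr 1 g f f'; rewrite !scale1r. Qed.
Let comp0l Y1 Y2 Y3 (f : Mor Y1 Y2) : (0 : Mor Y2 Y3) ∘ f = 0.
Proof. by apply: (addrI (0 ∘ f)); rewrite -compDl !addr0. Qed.
Let comp0r Y1 Y2 Y3 (g : Mor Y2 Y3) : g ∘ (0 : Mor Y1 Y2) = 0.
Proof. by apply: (addrI (g ∘ 0)); rewrite -compDr !addr0. Qed.
Let compZl Y1 Y2 Y3 k (g : Mor Y2 Y3) (f : Mor Y1 Y2) :
  (k *: g) ∘ f = k *: (g ∘ f).
Proof. by have := comp_linl k g 0 f; rewrite comp0l !addr0. Qed.
Let compZr Y1 Y2 Y3 k (g : Mor Y2 Y3) (f : Mor Y1 Y2) :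
  g ∘ (k *: f) = k *: (g ∘ f).
Proof. by have := comp_linr k g f 0; rewrite comp0r !addr0. Qed.

Fact Endop_mulA : associative mul.
Proof. by move=> a b c; rewrite /mul compA. Qed.
Fact Endop_mul1 : left_id (Idm X : Endop X) mul.
Proof. by move=> a; rewrite /mul compm1. Qed.
Fact Endop_mulr1 : right_id (Idm X : Endop X) mul.
Proof. by move=> a; rewrite /mul comp1m. Qed.
Fact Endop_mulDl : left_distributive mul +%R.
Proof. by move=> a b c; rewrite /mul compDr. Qed.
Fact Endop_mulDr : right_distributive mul +%R.
Proof. by move=> a b c; rewrite /mul compDl. Qed.
HB.instance Definition _ := GRing.Zmodule_isPzRing.Build (Endop X)
  Endop_mulA Endop_mul1 Endop_mulr1 Endop_mulDl Endop_mulDr.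

Definition Endop_scalar (k : K) : Endop X := k *: Idm X.
Fact Endop_scalar_zmod : zmod_morphism Endop_scalar.
Proof. by move=> k l; rewrite /Endop_scalar scalerBl. Qed.
Fact Endop_scalar_monoid : monoid_morphism Endop_scalar.
Proof.
split=> [|k l]; first by rewrite /Endop_scalar scale1r.
by rewrite /Endop_scalar [RHS]compZl compZr comp1m scalerA mulrC.
Qed.
HB.instance Definition _ :=
  GRing.isZmodMorphism.Build K (Endop X) Endop_scalar Endop_scalar_zmod.
HB.instance Definition _ :=
  GRing.isMonoidMorphism.Build K (Endop X) Endop_scalar Endop_scalar_monoid.
Fact Endop_scalarC (k : K) (a : Endop X) :
  Endop_scalar k * a = a * Endop_scalar k.
Proof. by rewrite [LHS]compZr [RHS]compZl compm1 comp1m. Qed.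
HB.instance Definition _ :=
  PzRing_isPzAlgebra.Build K (Endop X) Endop_scalarC.

(* The left End_E(X)^op-module Hom_E(X, Y). *)
Definition homod (Y : E) : Type := Mor X Y.
Section Homod.
Variable Y : E.
HB.instance Definition _ := GRing.Zmodule.copy (homod Y) (Mor X Y).
Let act (a : Endop X) (f : homod Y) : homod Y := (f : Mor X Y) ∘ (a : Mor X X).
Fact homod_scalerA a b f : act a (act b f) = act (a * b) f.
Proof. by rewrite /act -compA. Qed.
Fact homod_scale1r : left_id 1 act.
Proof. by move=> f; rewrite /act compm1. Qed.
Fact homod_scalerDr : right_distributive act +%R.
Proof. by move=> a f g; rewrite /act compDl. Qed.
Fact homod_scalerDl f : {morph act^~ f : a b / a + b}.
Proof. by move=> a b; rewrite /act compDr. Qed.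
HB.instance Definition _ := GRing.Zmodule_isLmodule.Build (Endop X) (homod Y)
  homod_scalerA homod_scale1r homod_scalerDr homod_scalerDl.
End Homod.

(* The image of Hom_E(X, p) : Hom_E(X, Y) -> Hom_E(X, Z). *)
Definition homod_im Y Z (p : Mor Y Z) : set (homod Z) :=
  [set f | exists h : Mor X Y, f = p ∘ h].
Fact homod_im_submod Y Z (p : Mor Y Z) : is_submod (homod_im p).
Proof.
split=> [|f g [h ->] [h' ->]|a f [h ->]].
- by exists 0; rewrite comp0r.
- by exists (h + h'); rewrite compDr.
- by exists (h ∘ (a : Mor X X)); rewrite compA.
Qed.
End Endop.
Arguments homod : clear implicits.

End LinearCategory.
Arguments homod {K E}.

Record exactCat (K : fieldType) := ExactCat {
  elin :> linCat K;
  has_dsum : forall (m : nat) (Xs : 'I_m -> elin), exists X, dsum Xs X;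
  confl : forall X Y Z : elin, Mor X Y -> Mor Y Z -> Prop;
  exactP : exact_axioms confl
}.
Arguments confl {K e X Y Z}.

Section ExactCategory.
Variables (K : fieldType) (E : exactCat K).

Definition projective (P : E) : Prop :=
  forall (Y Z : E) (g : Mor Y Z), deflation (@confl K E) g ->
    forall f : Mor P Z, exists h : Mor P Y, g ∘ h = f.
Definition injective_obj (I : E) : Prop :=
  forall (X Y : E) (f : Mor X Y), inflation (@confl K E) f ->
    forall g : Mor X I, exists h : Mor Y I, h ∘ f = g.

Record injpres (Y : E) := InjPres {
  ip_inj : E;
  ip_cosyz : E;
  ip_i : Mor Y ip_inj;
  ip_p : Mor ip_inj ip_cosyz;
  ip_confl : confl ip_i ip_p;
  ip_injective : injective_obj ip_inj
}.
End ExactCategory.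

Record frobCat (K : fieldType) := FrobCat {
  fexact :> exactCat K;
  enough_proj : forall X : fexact, exists (P : fexact) (p : Mor P X),
    projective P /\ deflation (@confl K fexact) p;
  enough_inj : forall Y : fexact, exists _ : injpres Y, True;
  proj_injP : forall X : fexact, projective X <-> injective_obj X
}.

Section Frobenius.
Variables (K : fieldType) (E : frobCat K).
Implicit Types X Y Z W P T U : E.

(* Ext^1_E(X, Y) as the first right derived functor of Hom_E(X, -): for a
   chosen conflation Y -> I -> C with I injective, it is the cokernel of
   Hom_E(X, I) -> Hom_E(X, C), as a left module over End_E(X)^op. *)
Definition the_injpres Y : injpres Y := projT1 (cid (enough_inj Y)).
Definition cosyz Y : E := ip_cosyz (the_injpres Y).
Definition Ext1 X Y : Type :=
  quotmod (Submod (homod_im_submod X (ip_p (the_injpres Y)))).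
HB.instance Definition _ X Y := GRing.Lmodule.on (Ext1 X Y).
Definition ext_class X Y (u : Mor X (cosyz Y)) : restr (Ext1 X Y) :=
  qpi (Submod (homod_im_submod X (ip_p (the_injpres Y)))) u.

(* [cosyz_map g c]: c is induced by g, so that Ext^1_E(X, g) maps the class of
   u to the class of c ∘ u. *)
Definition cosyz_map Y Y' (g : Mor Y Y') (c : Mor (cosyz Y) (cosyz Y')) : Prop :=
  exists h : Mor (ip_inj (the_injpres Y)) (ip_inj (the_injpres Y')),
    h ∘ ip_i (the_injpres Y) = ip_i (the_injpres Y') ∘ g /\
    c ∘ ip_p (the_injpres Y) = ip_p (the_injpres Y') ∘ h.

(* The stable category has the objects of E, and its morphisms X -> Y are those
   of E modulo the stably zero ones. *)
Definition stable0 X Y : set (Mor X Y) :=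
  [set f | exists P (a : Mor X P) (b : Mor P Y), projective P /\ f = b ∘ a].
Definition stable_eq X Y (f g : Mor X Y) : Prop := @stable0 X Y (f - g).
Definition stable_iso X Y (f : Mor X Y) : Prop :=
  exists g : Mor Y X, stable_eq (g ∘ f) (Idm X) /\ stable_eq (f ∘ g) (Idm Y).

(* A linear isomorphism Phi from Ext^1(Y, X) to the dual of Ext^1(X, Y),
   natural in X and Y. *)
Definition ext_duality : Prop :=
  exists Phi : forall X Y, restr (Ext1 Y X) -> restr (Ext1 X Y) -> K^o,
  [/\ forall X Y, (forall eta, linear (Phi X Y eta)) /\
        (forall xi, linear (fun eta => Phi X Y eta xi)),
      forall X Y (phi : {linear restr (Ext1 X Y) -> K^o}),
        exists! eta, forall xi, Phi X Y eta xi = phi xi,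
      forall X Y Y' (g : Mor Y Y') c (w : Mor Y' (cosyz X)) (u : Mor X (cosyz Y)),
        cosyz_map g c ->
        Phi X Y (ext_class (w ∘ g)) (ext_class u)
          = Phi X Y' (ext_class w) (ext_class (c ∘ u))
    & forall X X' Y (f : Mor X X') c (w : Mor Y (cosyz X)) (u : Mor X' (cosyz Y)),
        cosyz_map f c ->
        Phi X' Y (ext_class (c ∘ w)) (ext_class u)
          = Phi X Y (ext_class w) (ext_class (u ∘ f))].

Definition stably_2CY : Prop :=
  (forall X Y, exists d, vdim [set: Mor X Y] (@stable0 X Y) d) /\ ext_duality.

Definition cluster_tilting T : Prop :=
  forall X, in_add T X <-> forall xi : Ext1 T X, xi = 0.

Definition frobenius_cluster_category : Prop :=
  [/\ krull_schmidt E, stably_2CY, exists T, cluster_tilting T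
    & forall T, cluster_tilting T -> gldim_le (Endop T) 3].

(* Sink maps, source maps and approximations in the stable category. *)
Definition stable_rad X Y (f : Mor X Y) : Prop :=
  forall g : Mor Y X, stable_iso (Idm X - g ∘ f).
Definition right_minimal X Y (f : Mor X Y) : Prop :=
  forall h : Mor X X, stable_eq (f ∘ h) f -> stable_iso h.
Definition left_minimal X Y (f : Mor X Y) : Prop :=
  forall h : Mor Y Y, stable_eq (h ∘ f) f -> stable_iso h.
Definition sink_map U X Y (f : Mor X Y) : Prop :=
  [/\ right_minimal f, stable_rad f
    & forall W (h : Mor W Y), in_add U W -> stable_rad h ->
        exists k : Mor W X, stable_eq (f ∘ k) h].
Definition source_map U X Y (f : Mor X Y) : Prop :=
  [/\ left_minimal f, stable_rad f
    & forall W (h : Mor X W), in_add U W -> stable_rad h ->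
        exists k : Mor Y W, stable_eq (k ∘ f) h].
Definition min_right_approx U X Y (f : Mor X Y) : Prop :=
  right_minimal f /\
  forall W (h : Mor W Y), in_add U W -> exists k : Mor W X, stable_eq (f ∘ k) h.
Definition min_left_approx U X Y (f : Mor X Y) : Prop :=
  left_minimal f /\
  forall W (h : Mor X W), in_add U W -> exists k : Mor Y W, stable_eq (k ∘ f) h.

(* Us -i-> M -p-> Uk and Uk -i'-> M' -p'-> Us.  The last four conditions say
   that the induced triangles glue to an Auslander-Reiten 4-angle
   Uk -> M' -> M -> Uk in the sense of Iyama and Yoshino. *)
Definition exchange_sequences U (Uk Us M M' : E) (i : Mor Us M) (p : Mor M Uk)
    (i' : Mor Uk M') (p' : Mor M' Us) : Prop :=
  [/\ confl i p /\ confl i' p',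
      ~ (exists s : Mor Uk M, p ∘ s = Idm Uk) /\
      ~ (exists s : Mor Us M', p' ∘ s = Idm Us),
      in_add U M /\ in_add U M',
      sink_map U p /\ source_map U i'
    & min_right_approx U p' /\ min_left_approx U i].

(* Indices start at 0, so T_i is projective-injective if and only if r <= i. *)
Record basicCT (n r : nat) := BasicCT {
  ctT :> E;
  ctTi : 'I_n -> E;
  ctinj : forall i, Mor (ctTi i) ctT;
  ctprj : forall i, Mor ctT (ctTi i);
  ct_dsum : is_dsum ctinj ctprj;
  ct_tilting : cluster_tilting ctT;
  ct_indec : forall i, indecomposable (ctTi i);
  ct_basic : forall i j, isomorphic (ctTi i) (ctTi j) -> i = j;
  ct_rn : (r <= n)%N;
  ct_proj : forall i, projective (ctTi i) <-> (r <= i)%N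
}.

End Frobenius.

(* Singular homology with rational coefficients, and Euler characteristic. *)
Section EulerCharacteristic.
Variables (R : realType) (X : topologicalType).

Definition stdsimplex (p : nat) : set 'rV[R]_p.+1 :=
  [set t | (forall i, 0 <= t 0 i) /\ \sum_i t 0 i = 1].
Arguments stdsimplex p _ : clear implicits.

Definition face_fun (p : nat) (j : 'I_p.+2) (t : 'rV[R]_p.+1) : 'rV[R]_p.+2 :=
  \row_l (if unlift j l is Some k then t 0 k else 0).
Fact face_subproof p (j : 'I_p.+2) (t : stdsimplex p) :
  face_fun j (set_val t) \in stdsimplex p.+1.
Proof.
have [t0 t1] : stdsimplex p (set_val t) by exact: set_valP.
apply/mem_set; split.
  by move=> l; rewrite mxE; case: unlift.
rewrite (bigD1_ord j) //= mxE unlift_none add0r -[RHS]t1.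
by apply: eq_bigr => k _; rewrite mxE liftK.
Qed.
Definition face p (j : 'I_p.+2) (t : stdsimplex p) : stdsimplex p.+1 :=
  SigSub (face_subproof j t).

Definition simplex (p : nat) := continuousType (stdsimplex p) X.
Definition chain (p : nat) := simplex p -> rat^o.
Definition is_chain p : set (chain p) :=
  [set c | finite_set [set s | c s != 0]].
Definition bound p (c : chain p.+1) : chain p := fun tau =>
  \sum_(j < p.+2) (-1) ^+ j *
    \sum_(s \in [set s : simplex p.+1 | forall t, s (face j t) = tau t]) c s.

Definition cycles p : set (chain p) :=
  match p with
  | 0%N => @is_chain 0%N
  | q.+1 => [set c : chain q.+1 | is_chain c /\ forall s, bound c s = 0]
  end.
Definition boundaries p : set (chain p) :=
  [set c | exists2 b : chain p.+1, is_chain b & forall s, c s = bound b s].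
Definition betti (p : nat) : nat := quotdim (@cycles p) (@boundaries p).
Definition euler_char : int :=
  \sum_(p \in [set: nat]) (-1) ^+ p * (betti p)%:Z.
End EulerCharacteristic.

Section ClusterCharacter.
Variable R : realType.

Section Grassmannian.
Variables (A : pzAlgType R[i]) (M : lmodType A) (r : nat) (e : 'I_r -> A).

(* The dimension vector of N, where the e_i are idempotents of A. *)
Definition dimvec (N : set M) (v : 'rV[int]_r) : Prop :=
  forall i, exists2 d : nat, v 0 i = d%:Z
    & vdim ([set e i *: x | x in N] : set (restr M)) [set 0] d.

Variable v : 'rV[int]_r.

Definition Gr : Type :=
  set_type [set N : set M | is_submod N /\ dimvec N v].
HB.instance Definition _ := Choice.on Gr.

(* With respect to a basis b of M, the rows of a matrix B span a subspace. *)
Definition is_basis (m : nat) (b : 'I_m -> restr M) : Prop :=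
  forall x, exists! c : 'rV[R[i]]_m, x = \sum_j c 0 j *: b j.
Definition rowspan (m d : nat) (b : 'I_m -> restr M) (B : 'M[R[i]]_(d, m)) :
  set (restr M) := [set \sum_j (c *m B) 0 j *: b j | c in [set: 'rV[R[i]]_d]].

(* The analytic topology: the subspace topology from the Grassmannian of
   d-dimensional subspaces of M, which is a quotient of the open set of
   d x m matrices of rank d. *)
Definition Gr_open : set_system Gr :=
  [set O | forall (m d : nat) (b : 'I_m -> restr M)
       (B : 'M[(R[i] : numFieldType)]_(d, m)) (N : Gr),
     is_basis b -> row_free B -> set_val N = rowspan b B -> O N ->
     \forall B' \near B, forall N' : Gr,
       row_free B' -> set_val N' = rowspan b B' -> O N'].
Fact Gr_openT : Gr_open setT.
Proof. by move=> m d b B N _ _ _ _; apply: filterE. Qed.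
Fact Gr_openI : setI_closed Gr_open.
Proof.
move=> O1 O2 o1 o2 m d b B N bb fB eN [O1N O2N].
have h1 := o1 m d b B N bb fB eN O1N; have h2 := o2 m d b B N bb fB eN O2N.
by apply: filterS2 h1 h2 => B' h1' h2' N' fB' eN'; split; [apply: h1'|apply: h2'].
Qed.
Fact Gr_open_bigU (I : Type) (f : I -> set Gr) :
  (forall i, Gr_open (f i)) -> Gr_open (\bigcup_i f i).
Proof.
move=> of_ m d b B N bb fB eN [i _ fiN].
have h := of_ i m d b B N bb fB eN fiN.
by apply: filterS h => B' h' N' fB' eN'; exists i => //; apply: h'.
Qed.
HB.instance Definition _ := isOpenTopological.Build Gr
  Gr_openT Gr_openI Gr_open_bigU.
End Grassmannian.

(* Laurent polynomials C[x_1^{+-1}, .., x_n^{+-1}], as elements of the field of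
   rational functions. *)
Section Laurent.
Variable n : nat.
Definition ratfun := {fraction (mpoly n R[i])}.
Definition lvar (i : 'I_n) : ratfun := tofrac (mpolyX R[i] (mnm1 i)).
Definition lmonom (a : 'I_n -> int) : ratfun := \prod_i lvar i ^ a i.
(* p is a C-linear combination of Laurent monomials of degree d, where x_i has
   degree g i. *)
Definition laurent_homog (Ab : zmodType) (g : 'I_n -> Ab) (d : Ab) (p : ratfun) :
  Prop := exists (m : nat) (c : 'I_m -> R[i]) (a : 'I_m -> 'I_n -> int),
    (forall j, \sum_i g i *~ a j i = d) /\
    p = \sum_j tofrac (mpolyC n (c j)) * lmonom (a j).
End Laurent.

Variables (E : frobCat R[i]) (n r : nat) (T : basicCT E n r).
Local Notation Lambda := (Endop (ctT T)).

Definition Fmod (X : E) : lmodType Lambda := homod (ctT T) X.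
Definition Emod (X : E) : lmodType Lambda := Ext1 (ctT T) X.
Definition simple_top (i : 'I_n) : lmodType Lambda :=
  quotmod (rad (Fmod (ctTi T i))).

(* Finitely generated modules over the quotient of Lambda by the endomorphisms
   that factor through projective objects. *)
Definition stable_mod (M : lmodType Lambda) : Prop :=
  fgen [set: M] /\
  forall (a : Lambda) (x : M), stable0 (a : Mor (ctT T) (ctT T)) -> a *: x = 0.

(* The idempotent of T_i, for i < r. *)
Definition ctidem (i : 'I_r) : Lambda :=
  let j := widen_ord (ct_rn T) i in ctinj T j ∘ ctprj T j.

Definition dimpair (v : 'rV[int]_r) (i : 'I_n) : int :=
  xget 0 [set z | exists M : lmodType Lambda,
    [/\ stable_mod M, dimvec ctidem [set: M] v & z = euler M (simple_top i)]].

Definition cluster_char (X : E) : ratfun n :=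
  lmonom (fun i => euler (Fmod X) (simple_top i)) *
  \sum_(v \in [set: 'rV[int]_r])
    (euler_char R (Gr (Emod X) ctidem v))%:~R * lmonom (fun i => - dimpair v i).

Section Grading.
Variables (Ab : zmodType) (G : K0sum Lambda Ab).
Definition grading : Prop :=
  forall M : lmodType Lambda, stable_mod M -> eulerK0 M G = 0.
Definition deg (X : E) : Ab := eulerK0 (Fmod X) G.
End Grading.

End ClusterCharacter.

(* Main.v *)
Require Import Defs.
From HB Require Import structures.
From mathcomp Require Import all_boot all_order all_algebra.
From mathcomp Require mpoly.
Import -(notations) mpoly.
From mathcomp Require Import complex ring.
From mathcomp Require Import all_classical all_reals.

(* For finitely generated M and finite dimensional N, a resolution P of M by
   finitely generated projectives gives, as Ext^i(M, N) = 0 for i > 3,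
     <M, N>_e = sum_(i < 4) (-1)^i dim Hom(P_i, N) + dim Z^4(Hom(P, N)),
   and all the terms on the right are additive on short exact sequences in
   either variable: for Z^4 because Z^4 = B^4 there.  A conflation
   X -> Y -> Z gives an exact sequence 0 -> FX -> FY -> FZ -> C -> 0 with C a
   module over the stable endomorphism algebra, on which the grading vanishes:
   this is (ii), and (iii) is the case of the exchange sequences.
   For (i), T_j has a local endomorphism ring, so the radical of P_j is
   {h | h o inj_j is not invertible} and every nonzero module over the stable
   endomorphism algebra contains some S_j.  Removing these one at a time shows
   that <M, S_i>_e depends only on the dimension vector of M.  Hence the degree
   of the monomial with exponents <v, S_i>_e is <M, G>_e = 0 as soon as some M
   has dimension vector v, and if none has then the exponents are all 0 by
   convention; in both cases the v-th term of the cluster character has degree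
   <FX, G>_e. *)

Set Implicit Arguments.
Unset Strict Implicit.
Unset Printing Implicit Defensive.

Import GRing.Theory.
Local Open Scope ring_scope.

(** * Dimensions of subquotients *)

Section Submodules.
Variables (A : pzRingType) (M : lmodType A).

Lemma submod_sum (I : Type) (s : seq I) (P : pred I) (F : I -> M) (N : set M) :
  is_submod N -> (forall i, P i -> N (F i)) -> N (\sum_(i <- s | P i) F i).
Proof. by case=> N0 ND _ NF; apply: big_ind. Qed.

Lemma submodB (N : set M) x y : is_submod N -> N x -> N y -> N (x - y).
Proof. by case=> _ ND NZ Nx Ny; rewrite -scaleN1r; apply: ND => //; apply: NZ. Qed.

Lemma submod_subr (N : set M) x y :
  is_submod N -> N (x - y) -> N y -> N x.
Proof. by case=> _ ND NZ Nxy Ny; rewrite -[x](subrK y); apply: ND. Qed.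

Lemma submod0 : is_submod [set (0 : M)].
Proof.
by split=> [//|x y -> ->|a x ->] /=; rewrite ?addr0 ?scaler0.
Qed.

Lemma submodT : is_submod [set: M].
Proof. by []. Qed.

End Submodules.

Section Dimension.
Variables (K : fieldType).
Implicit Type V : lmodType K.

Definition lcomb (V : lmodType K) (d : nat) (c : 'rV[K]_d) (b : 'I_d -> V) : V :=
  \sum_i c 0 i *: b i.

Lemma lcombB V d (c c' : 'rV[K]_d) (b : 'I_d -> V) :
  lcomb (c - c') b = lcomb c b - lcomb c' b.
Proof.
by rewrite /lcomb -sumrB; apply: eq_bigr => i _; rewrite !mxE scalerBl.
Qed.

Lemma lcomb0 V d (b : 'I_d -> V) : lcomb 0 b = 0.
Proof. by rewrite /lcomb big1 // => i _; rewrite mxE scale0r. Qed.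

Lemma lcomb_row_mx V d e (c : 'rV[K]_d) (c' : 'rV[K]_e) (b : 'I_(d + e) -> V) :
  lcomb (row_mx c c') b
  = lcomb c (fun i => b (lshift e i)) + lcomb c' (fun i => b (rshift d i)).
Proof.
rewrite /lcomb big_split_ord; congr (_ + _); apply: eq_bigr => i _.
  by rewrite row_mxEl.
by rewrite row_mxEr.
Qed.

Lemma lcomb_submod V d (c : 'rV[K]_d) (b : 'I_d -> V) (Z : set V) :
  is_submod Z -> (forall i, Z (b i)) -> Z (lcomb c b).
Proof. by move=> sZ Zb; apply: submod_sum => // i _; case: sZ => _ _; apply. Qed.

(** If k exceeded m, the k x m matrix of coordinates of the b_i would have a nonzero vector in its
    left kernel, that is, a nontrivial relation among the b_i modulo B. *)
Lemma indep_le_span V (B : set V) m k (x : 'I_m -> V) (b : 'I_k -> V) :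
    is_submod B ->
    (forall i, exists c : 'rV_m, B (b i - lcomb c x)) ->
    (forall c : 'rV_k, B (lcomb c b) -> c = 0) ->
  (k <= m)%N.
Proof.
move=> sB /choice[A hA] indep; rewrite leqNgt; apply/negP => mk.
pose M := \matrix_i A i.
have : kermx M != 0.
  rewrite -mxrank_eq0 mxrank_ker subn_eq0 -ltnNge.
  exact: leq_ltn_trans (rank_leq_col M) mk.
case/matrix0Pn => i [j kij].
suff /indep r0 : B (lcomb (row i (kermx M)) b).
  by move/rowP/(_ j) : r0 kij; rewrite !mxE => ->; rewrite eqxx.
set c := row i _.
have cM : c *m M = 0 by apply/sub_kermxP; apply: row_sub.
have -> : lcomb c b = \sum_l c 0 l *: (b l - lcomb (A l) x).
  under [RHS]eq_bigr do rewrite scalerBr.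
  rewrite sumrB -[LHS]subr0; congr (_ - _).
  rewrite -[LHS](lcomb0 x) -cM /lcomb.
  under [LHS]eq_bigr do rewrite mxE scaler_suml.
  rewrite exchange_big; apply: eq_bigr => l _.
  rewrite scaler_sumr; apply: eq_bigr => j' _.
  by rewrite scalerA !mxE.
by apply: submod_sum => // l _; case: sB => _ _; apply.
Qed.

(** Uniqueness of the coordinates of 0 is linear independence modulo B. *)
Lemma vdim_indep V (Z B : set V) d : is_submod Z -> vdim Z B d ->
  exists b : 'I_d -> V, [/\ forall i, Z (b i),
    forall z, Z z -> exists c, B (z - lcomb c b)
    & forall c, B (lcomb c b) -> is_submod B -> c = 0].
Proof.
move=> sZ [b [Zb bb]]; exists b; split=> // [z /bb[c [Bc _]]|c Bc sB].
  by exists c.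
have [c0 [_ c0P]] := bb 0 (let: And3 Z0 _ _ := sZ in Z0).
rewrite -[c]opprK -[- c](c0P (- c)) ?(c0P 0) ?oppr0 //.
  by rewrite -/(lcomb _ _) lcomb0 subrr; case: sB.
by rewrite -/(lcomb _ _) -[- c]sub0r lcombB lcomb0 !sub0r opprK.
Qed.

Lemma vdim_uniq V (Z B : set V) d d' : is_submod Z -> is_submod B ->
  vdim Z B d -> vdim Z B d' -> d = d'.
Proof.
move=> sZ sB /(vdim_indep sZ)[b [Zb sb ib]] /(vdim_indep sZ)[b' [Zb' sb' ib']].
apply/eqP; rewrite eqn_leq (@indep_le_span _ B _ _ b' b) //=; last 2 first.
- by move=> i; apply: sb'.
- by move=> c /ib; apply.
apply: (@indep_le_span _ B _ _ b b') => // [i|c /ib'].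
  exact: sb.
exact.
Qed.

Lemma vdim_intro V (Z B : set V) d (b : 'I_d -> V) : is_submod B ->
    (forall i, Z (b i)) -> (forall z, Z z -> exists c, B (z - lcomb c b)) ->
    (forall c, B (lcomb c b) -> c = 0) ->
  vdim Z B d.
Proof.
move=> sB Zb sb ib; exists b; split=> // z Zz; have [c Bc] := sb _ Zz.
exists c; split=> // c' Bc'; apply/eqP; rewrite -subr_eq0; apply/eqP/ib.
have := submodB sB Bc' Bc.
by rewrite lcombB opprB addrC -addrA (addrA _ z) addNr add0r.
Qed.

(** A family in Z independent modulo B has at most m members by [indep_le_span], and one of maximal
    size spans. *)
Lemma vdim_ex V (Z B : set V) m (x : 'I_m -> V) : is_submod Z -> is_submod B ->
  (forall z, Z z -> exists c, B (z - lcomb c x)) -> exists d, vdim Z B d.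
Proof.
move=> sZ sB Zx.
pose P k := exists b : 'I_k -> V,
  (forall i, Z (b i)) /\ forall c, B (lcomb c b) -> c = 0.
have P0 : exists k, `[< P k >].
  exists 0%N; apply/asboolP; exists (fun=> 0).
  by split=> [|c _]; [case | apply/rowP; case].
have Pm k : `[< P k >] -> (k <= m)%N.
  case/asboolP => b [Zb ib]; apply: (@indep_le_span _ B _ _ x b) => // i.
  exact: Zx.
case: (ex_maxnP P0 Pm) => d /asboolP[b [Zb ib]] dmax.
exists d; apply: (vdim_intro sB Zb _ ib) => z Zz; apply: contrapT => nz.
(* Otherwise z could be adjoined to the maximal family b. *)
have : (d + 1 <= d)%N; last by rewrite addn1 ltnn.
apply: dmax; apply/asboolP.
exists (fun i => if fintype.split i is inl j then b j else z); split=> [i|c].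
  by case: fintype.split.
rewrite -[c]hsubmxK lcomb_row_mx.
set u := lsubmx c; set t := rsubmx c.
under eq_fun do rewrite (unsplitK (inl _)).
rewrite [X in _ + X]/lcomb big_ord1 (unsplitK (inr _)).
(* A relation with a nonzero coefficient at z could be divided by it, which would put z in the span
   of b modulo B. *)
case: (eqVneq (t 0 0) 0) => [t0|t0 Bc].
  rewrite t0 scale0r addr0 => /ib ->.
  have -> : t = 0 by apply/rowP => i; rewrite ord1 t0 mxE.
  by rewrite row_mx0.
case: nz; exists (- (t 0 0)^-1 *: u).
have -> : z - lcomb (- (t 0 0)^-1 *: u) b = (t 0 0)^-1 *: (lcomb u b + t 0 0 *: z).
  rewrite scalerDr scalerA mulVf // scale1r addrC; congr (_ + _).
  rewrite /lcomb scaler_sumr -sumrN; apply: eq_bigr => i _.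
  by rewrite !mxE scalerA mulNr scaleNr opprK.
by case: sB => _ _; apply.
Qed.

Lemma vdim_ex_fin V (Z B : set V) (I : finType) (x : I -> V) :
    is_submod Z -> is_submod B ->
    (forall z, Z z -> exists c : I -> K, B (z - \sum_i c i *: x i)) ->
  exists d, vdim Z B d.
Proof.
move=> sZ sB Zx; apply: (@vdim_ex _ _ _ _ (x \o enum_val)) => // z /Zx[c Bc].
exists (\row_k c (enum_val k)); rewrite /lcomb; under eq_bigr do rewrite mxE.
move: Bc; congr (B (z - _)).
exact: (big_enum_val (fun i => c i *: x i)).
Qed.

(** A basis of W modulo B still spans the smaller Z modulo the larger B'. *)
Lemma vdim_sub_ex V (W Z B B' : set V) d : is_submod W -> is_submod Z ->
    is_submod B' -> (Z `<=` W)%classic -> (B `<=` B')%classic ->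
  vdim W B d -> exists a, vdim Z B' a.
Proof.
move=> sW sZ sB' ZW BB' /(vdim_indep sW)[b [_ sb _]].
by apply: (vdim_ex (x := b)) => // z /ZW/sb[c /BB']; exists c.
Qed.

Lemma vdim_add V (W Z B : set V) a b : is_submod W -> is_submod Z ->
    is_submod B -> (Z `<=` W)%classic -> (B `<=` Z)%classic ->
  vdim Z B a -> vdim W Z b -> vdim W B (a + b).
Proof.
move=> sW sZ sB ZW BZ /(vdim_indep sZ)[x [Zx sx ix]].
move=> /(vdim_indep sW)[y [Wy sy iy]].
pose xy (i : 'I_(a + b)) := match fintype.split i with inl j => x j | inr j => y j end.
have xyE c c' : lcomb (row_mx c c') xy = lcomb c x + lcomb c' y.
  rewrite lcomb_row_mx; congr (_ + _); apply: eq_bigr => i _.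
    by rewrite /xy (unsplitK (inl _)).
  by rewrite /xy (unsplitK (inr _)).
apply: (vdim_intro (b := xy)) => // [i|z /sy[c Zc]|c].
- by rewrite /xy; case: fintype.split => j //; apply: ZW.
- have [c' Bc'] := sx _ Zc; exists (row_mx c' c).
  by rewrite xyE opprD addrCA addrC.
- rewrite -[c]hsubmxK xyE => Bc.
  have c20 : rsubmx c = 0.
    apply: iy => //; have := submodB sZ (BZ _ Bc) (lcomb_submod (lsubmx c) sZ Zx).
    by rewrite addrAC subrr add0r.
  move: Bc; rewrite c20 lcomb0 addr0 => /ix -> //; exact: row_mx0.
Qed.

Lemma vdim0 V (Z B : set V) : is_submod B -> (Z `<=` B)%classic -> vdim Z B 0.
Proof.
move=> sB ZB; apply: (vdim_intro (b := fun=> 0)) => // [[]//|z Zz|c _].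
  by exists 0; rewrite lcomb0 subr0; apply: ZB.
by apply/rowP; case.
Qed.

Lemma vdim0_sub V (Z B : set V) : vdim Z B 0 -> (Z `<=` B)%classic.
Proof. by case=> b [_ bP] z /bP[c [+ _]]; rewrite big_ord0 subr0. Qed.

Lemma lcomb_lin V (V' : lmodType K) (phi : V -> V') d (c : 'rV_d) b :
  linear phi -> phi (lcomb c b) = lcomb c (phi \o b).
Proof.
move=> lphi; pose f : {linear V -> V'} :=
  HB.pack phi (GRing.isLinear.Build _ _ _ _ phi lphi).
rewrite -[phi]/(f : _ -> _) linear_sum /=; apply: eq_bigr => i _.
exact: (linearZ_LR f).
Qed.

Lemma linB V (V' : lmodType K) (phi : V -> V') x y :
  linear phi -> phi (x - y) = phi x - phi y.
Proof.
move=> lphi; pose f : {linear V -> V'} :=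
  HB.pack phi (GRing.isLinear.Build _ _ _ _ phi lphi).
exact: (linearB f).
Qed.

Lemma lin0 V (V' : lmodType K) (phi : V -> V') : linear phi -> phi 0 = 0.
Proof. by move=> lphi; have := linB 0 0 lphi; rewrite !subrr. Qed.

Section Transfer.
Variables (V V' : lmodType K) (phi : V -> V') (Z B : set V) (Z' B' : set V').
Hypotheses (lphi : linear phi) (sZ : is_submod Z) (sB : is_submod B).
Hypotheses (sZ' : is_submod Z') (sB' : is_submod B').
Hypothesis ZZ' : forall z, Z z -> Z' (phi z).
Hypothesis BB' : forall z, Z z -> B z <-> B' (phi z).
Hypothesis surj : forall z', Z' z' -> exists2 z, Z z & B' (z' - phi z).

(** The hypotheses of the section say that phi induces an isomorphism from Z modulo B to Z' modulo
    B'. Bases go forward through phi, and back through preimages chosen up to B'. *)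
Lemma vdim_transfer d : vdim Z B d <-> vdim Z' B' d.
Proof.
split=> [/(vdim_indep sZ)[b [Zb sb ib]]|/(vdim_indep sZ')[b' [Zb' sb' ib']]].
  apply: (vdim_intro (b := phi \o b)) => // [i|z' /surj[z Zz Bz]|c].
  - exact: ZZ'.
  - have [c Bc] := sb _ Zz; exists c; rewrite -(lcomb_lin _ _ lphi).
    have ZBc : Z (z - lcomb c b) by apply: submodB => //; apply: lcomb_submod.
    have /(BB' ZBc) := Bc; rewrite linB // => B'c.
    have [_ BD _] := sB'; have := BD _ _ Bz B'c.
    by rewrite addrA subrK.
  - rewrite -(lcomb_lin _ _ lphi) => /BB' - /(_ (lcomb_submod c sZ Zb)) /ib; exact.
have /choice[b hb] : forall i, exists z, Z z /\ B' (b' i - phi z).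
  by move=> i; have [z] := surj (Zb' i); exists z.
have Zb i : Z (b i) by case: (hb i).
have Bb c : B' (lcomb c b' - phi (lcomb c b)).
  rewrite (lcomb_lin _ _ lphi) /lcomb -sumrB; apply: submod_sum => // i _.
  by rewrite -scalerBr; have [_ _] := sB'; apply; case: (hb i).
apply: (vdim_intro (b := b)) => // [z Zz|c].
  have [c Bc] := sb' _ (ZZ' Zz); exists c.
  apply/BB'; first by apply: submodB => //; apply: lcomb_submod.
  rewrite linB //; have [_ BD _] := sB'; have := BD _ _ Bc (Bb c).
  by rewrite addrA subrK.
move/(BB' (lcomb_submod c sZ Zb)) => B'c; apply: ib' => //.
exact: submod_subr (Bb c) B'c.
Qed.
End Transfer.

(** Exactness is asked only on Z1, Z2 and Z3, since the ambient spaces will be spaces of all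
    functions. The kernel of g in Z2 corresponds to Z1 under f, and Z2 modulo this kernel to Z3
    under g. *)
Lemma vdim_ses (V1 V2 V3 : lmodType K) (f : V1 -> V2) (g : V2 -> V3)
    (Z1 : set V1) (Z2 : set V2) (Z3 : set V3) a b :
    linear f -> linear g -> is_submod Z1 -> is_submod Z2 -> is_submod Z3 ->
    (forall x, Z1 x -> f x = 0 -> x = 0) ->
    (forall x, Z1 x -> Z2 (f x)) -> (forall y, Z2 y -> Z3 (g y)) ->
    (forall x, Z1 x -> g (f x) = 0) ->
    (forall y, Z2 y -> g y = 0 -> exists2 x, Z1 x & f x = y) ->
    (forall z, Z3 z -> exists2 y, Z2 y & g y = z) ->
  vdim Z1 [set 0]%classic a -> vdim Z3 [set 0]%classic b ->
  vdim Z2 [set 0]%classic (a + b).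
Proof.
move=> lf lg s1 s2 s3 fi f12 g23 gf ex gs d1 d3.
pose Zk : set V2 := [set y | Z2 y /\ g y = 0]%classic.
have g0 := lin0 lg.
have f0 := lin0 lf.
have sk : is_submod Zk.
  case: s2 => Z0 ZD ZZ; split=> [|x y [Zx gx] [Zy gy]|k x [Zx gx]].
  - by split.
  - by split; [apply: ZD | rewrite -[x]scale1r lg gx gy scaler0 addr0].
  - by split; [apply: ZZ | rewrite -[_ *: x]addr0 lg gx g0 scaler0 addr0].
have s0 (V : lmodType K) := submod0 V.
apply: (@vdim_add _ _ Zk) => //; first by move=> y [].
- by move=> _ ->; case: sk.
- apply/(@vdim_transfer _ _ f Z1 [set 0]%classic) => //.
  + by move=> z Zz; split; [apply: f12 | apply: gf].
  + by move=> z Zz; split=> [->|/fi]; [rewrite /= f0 | apply].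
  + by move=> y [/ex /[apply] [[x Zx <-]]]; exists x => //=; rewrite subrr.
- apply/(@vdim_transfer _ _ g Z2 Zk Z3 [set 0]%classic) => //.
  + by move=> z Zz; split=> [[]|].
  + by move=> z /gs[y Zy <-]; exists y => //=; rewrite subrr.
Qed.

End Dimension.

(** * Projective resolutions and Ext *)

(** Resolutions, chain maps and homotopies are built degree by degree, each choice depending on the
    preceding one and its type on the degree. *)
Lemma dep_choice (X : nat -> Type) (R : forall i, X i -> X i.+1 -> Prop)
    (x0 : X 0%N) : (forall i x, exists y, R i x y) ->
  exists f : forall i, X i, f 0%N = x0 /\ forall i, R i (f i) (f i.+1).
Proof.
move=> H; pose next i x := projT1 (cid (H i x)).
exists (nat_rect X x0 next); split=> // i /=.
exact: (projT2 (cid (H i _))).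
Qed.

Section Lifting.
Variable A : pzRingType.
Implicit Types M N P U V : lmodType A.

Definition lin_pack U V (f : U -> V) (lf : linear f) : {linear U -> V} :=
  HB.pack f (GRing.isLinear.Build _ _ _ _ f lf).

Lemma linear_pack U V (f : U -> V) :
  linear f -> exists g : {linear U -> V}, forall x, g x = f x.
Proof. by move=> lf; exists (lin_pack lf). Qed.

Lemma ker_is_submod U V (g : {linear U -> V}) : is_submod [set x | g x = 0]%classic.
Proof.
split=> [|x y gx gy|a x gx] /=; first exact: linear0.
  by rewrite linearD gx gy addr0.
by rewrite linearZ_LR gx scaler0.
Qed.

Definition ker_submod U V (g : {linear U -> V}) := Submod (ker_is_submod g).

Lemma im_is_submod U V (g : {linear U -> V}) :
  is_submod [set y | exists x, g x = y]%classic.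
Proof.
split=> [|_ _ [x <-] [y <-]|a _ [x <-]].
- by exists 0; rewrite linear0.
- by exists (x + y); rewrite linearD.
- by exists (a *: x); rewrite linearZ_LR.
Qed.

Definition im_submod U V (g : {linear U -> V}) := Submod (im_is_submod g).

Lemma preim_is_submod U V (g : {linear U -> V}) (N : set V) : is_submod N ->
  is_submod [set x | N (g x)]%classic.
Proof.
move=> [N0 ND NZ]; split=> [|x y Nx Ny|a x Nx] /=.
- by rewrite linear0.
- by rewrite linearD; apply: ND.
- by rewrite linearZ_LR; apply: NZ.
Qed.

Section QuotientProjection.
Variables (M : lmodType A) (N : submod M).

Lemma qpi_linear : linear (qpi N).
Proof.
move=> a x y; rewrite [in RHS]/GRing.scale /= -qpiZ.
by rewrite /qpi [LHS]Quotient.pi_add.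
Qed.
HB.instance Definition _ := GRing.isLinear.Build A M (quotmod N) _ (qpi N) qpi_linear.

Lemma qpi_surj (q : quotmod N) : exists x, qpi N x = q.
Proof. exists (repr (q : Quotient.quot (smclosed N))); exact: reprK. Qed.

Lemma qpi_eq0 x : qpi N x = 0 <-> smcar N x.
Proof. by rewrite -(linear0 (qpi N)) qpi_eq subr0. Qed.

Lemma quot_lift V (f : {linear M -> V}) : (forall x, smcar N x -> f x = 0) ->
  exists g : {linear quotmod N -> V}, forall x, g (qpi N x) = f x.
Proof.
move=> fN; pose h (q : quotmod N) := f (projT1 (cid (qpi_surj q))).
have hE x : h (qpi N x) = f x.
  rewrite /h; case: cid => y /= /qpi_eq/fN.
  by rewrite linearB => /eqP; rewrite subr_eq0 => /eqP.
have [|g gh] := @linear_pack (quotmod N) V h.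
  move=> a q q'; have [x <-] := qpi_surj q; have [y <-] := qpi_surj q'.
  by rewrite -linearP !hE linearP.
by exists g => x; rewrite gh.
Qed.
End QuotientProjection.

(* [projmod] only lifts along surjections: g is replaced by U -> U / ker g. *)
Lemma proj_lift P U V (g : {linear U -> V}) (f : {linear P -> V}) : projmod P ->
  (forall p, exists u, g u = f p) ->
  exists h : {linear P -> U}, forall p, g (h p) = f p.
Proof.
move=> pP /choice[u gu]; pose k := ker_submod g.
have [|f' f'E] := @linear_pack P (quotmod k) (fun p => qpi k (u p)).
  move=> a x y; rewrite -linearP; apply/qpi_eq => /=.
  by rewrite linearB linearP !gu linearP subrr.
have [h hE] := pP U _ (qpi k) f' (@qpi_surj _ k).
exists h => p; have := hE p; rewrite f'E => /qpi_eq /=.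
by rewrite linearB gu => /eqP; rewrite subr_eq0 => /eqP.
Qed.

Lemma prd_prd M (P : projres M) i x : prd P i (prd P i.+1 x) = 0.
Proof. by apply/pr_exactS; exists x. Qed.

Lemma pre_prd M (P : projres M) x : pre P (prd P 0 x) = 0.
Proof. by apply/pr_exact0; exists x. Qed.

(** The comparison theorem: projectivity of the P_i and exactness of Q extend u to a chain map. *)
Lemma chain_lift M M' (P : projres M) (Q : projres M') (u : {linear M -> M'}) :
  exists f : forall i, {linear prP P i -> prP Q i},
    (forall x, pre Q (f 0%N x) = u (pre P x)) /\
    forall i x, prd Q i (f i.+1 x) = f i (prd P i x).
Proof.
have [f0 f0E] : exists f0 : {linear prP P 0 -> prP Q 0},
    forall x, pre Q (f0 x) = (u \o pre P) x.
  by apply: proj_lift => [|p]; [apply: pr_proj | apply: pr_surj].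
(* Each f_i is stored with the condition that makes the next lift possible: f_i d takes its values
   in the image of d. *)
pose X i := {f : {linear prP P i -> prP Q i} |
              forall x, exists y, prd Q i y = f (prd P i x)}.
have i0 x : exists y, prd Q 0 y = f0 (prd P 0 x).
  by apply/pr_exact0; rewrite f0E /= pre_prd linear0.
have [|F [F0 FS]] := @dep_choice X
  (fun i f g => forall x, prd Q i (sval g x) = sval f (prd P i x)) (exist _ f0 i0).
  move=> i [f fi] /=.
  have [|g gE] := @proj_lift _ _ _ (prd Q i) (f \o prd P i) (@pr_proj _ _ P i.+1).
    exact: fi.
  have gi x : exists y, prd Q i.+1 y = g (prd P i.+1 x).
    by apply/pr_exactS; rewrite gE /= prd_prd linear0.
  by exists (exist _ g gi).
exists (fun i => sval (F i)); split=> [x|//].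
by rewrite F0 f0E.
Qed.

Lemma chain_homotopy M (P : projres M) (g : forall i, {linear prP P i -> prP P i}) :
    (forall x, pre P (g 0%N x) = pre P x) ->
    (forall i x, prd P i (g i.+1 x) = g i (prd P i x)) ->
  exists s : forall i, {linear prP P i -> prP P i.+1},
    (forall x, prd P 0 (s 0%N x) = g 0%N x - x) /\
    forall i x, prd P i.+1 (s i.+1 x) = g i.+1 x - x - s i (prd P i x).
Proof.
move=> g0 gS.
have [s0 s0E] : exists s0 : {linear prP P 0 -> prP P 1},
    forall x, prd P 0 (s0 x) = (g 0%N \- idfun) x.
  apply: proj_lift => [|p]; first exact: pr_proj.
  by apply/pr_exact0; rewrite /= linearB g0 subrr.
(* The condition stored with s amounts to d (g - 1 - s d) = 0, so that g - 1 - s d lifts through the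
   next differential. *)
pose X i := {s : {linear prP P i -> prP P i.+1} |
  forall x, prd P i (s (prd P i x)) = g i (prd P i x) - prd P i x}.
have i0 x : prd P 0 (s0 (prd P 0 x)) = g 0%N (prd P 0 x) - prd P 0 x by rewrite s0E.
have [|F [F0 FS]] := @dep_choice X (fun i s t => forall x,
    prd P i.+1 (sval t x) = g i.+1 x - x - sval s (prd P i x)) (exist _ s0 i0).
  move=> i [s si] /=.
  have [|t tE] := @proj_lift _ _ _ (prd P i.+1)
      ((g i.+1 \- idfun) \- (s \o prd P i)) (@pr_proj _ _ P i.+1).
    by move=> p; apply/pr_exactS; rewrite /= !linearB /= gS si subrr.
  have ti x : prd P i.+1 (t (prd P i.+1 x)) = g i.+1 (prd P i.+1 x) - prd P i.+1 x.
    by rewrite tE /= prd_prd linear0 subr0.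
  by exists (exist _ t ti).
exists (fun i => sval (F i)); split=> [x|//].
by rewrite F0 s0E.
Qed.

End Lifting.

Arguments ext_cocycle {K A M} N P i _.
Arguments ext_cobound {K A M} N P i _.

(** * Cochains, cocycles and coboundaries of Hom(P, N) *)

Section Cochain.
Variables (K : fieldType) (A : pzAlgType K).
Implicit Types (M N P : lmodType A).

Lemma restr_scaleE N (k : K) (x : restr N) : k *: x = (algmap k : A) *: (x : N).
Proof. by []. Qed.

Lemma restr_linear M N (f : {linear M -> N}) :
  linear (f : restr M -> restr N).
Proof. by move=> k x y; rewrite !restr_scaleE; apply: linearP. Qed.

(** Hom_A(P, N) as a subset of the space of all functions, which carries the K-vector space
    structure used by [vdim]. *)
Definition cochain P N : set (P -> restr N) :=
  [set f | linear (f : P -> N)]%classic.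

Lemma cochain_submod P N : is_submod (@cochain P N).
Proof.
split=> [|f g lf lg|k f lf] a x y.
- by rewrite /= scaler0 addr0.
- rewrite -!/((f + g) _) !fctE.
  have -> : f (a *: x + y) = a *: (f x : N) + f y := lf a x y.
  have -> : g (a *: x + y) = a *: (g x : N) + g y := lg a x y.
  by rewrite scalerDr addrACA.
(* Scalars of K preserve A-linearity because they are central in A. *)
- have -> : (k *: f) (a *: x + y) = (algmap k : A) *: (f (a *: x + y) : N) by [].
  have -> : f (a *: x + y) = a *: (f x : N) + f y := lf a x y.
  by rewrite scalerDr !scalerA algmapC.
Qed.

Lemma postcomp_linear (S : Type) M N (f : {linear M -> N}) :
  linear (fun u : S -> restr M => (f \o u : S -> restr N)).
Proof. by move=> k u v; apply/funext => x; apply: restr_linear. Qed.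

Lemma cocycleE M N (P : projres M) i f :
  ext_cocycle N P i f <->
  cochain f /\ forall y, f (prd P i y) = 0.
Proof.
split=> [[g [fg gd]]|[/linear_pack[g gE] fd]].
  split=> [a x y|y]; last by rewrite fg gd.
  by rewrite !fg; apply: linearP.
by exists g; split=> [x|y]; rewrite gE.
Qed.

Lemma coboundSE M N (P : projres M) i f :
  ext_cobound N P i.+1 f <->
  exists2 g : prP P i -> restr N, cochain g & f = g \o prd P i.
Proof.
split=> [[g fg]|[g /linear_pack[h hE] ->]].
  exists g; first exact: linearP.
  exact/funext.
by exists h => x; rewrite /= hE.
Qed.

Lemma cocycle_submod M N (P : projres M) i : is_submod (ext_cocycle N P i).
Proof.
have [C0 CD CZ] := cochain_submod (prP P i) N.
split=> [|f g /cocycleE[cf fd] /cocycleE[cg gd]|k f /cocycleE[cf fd]]; apply/cocycleE.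
- by split.
- by split=> [|y]; [apply: CD | rewrite fctE fd gd addr0].
- by split=> [|y]; [apply: CZ | rewrite fctE fd scaler0].
Qed.

Lemma cobound_submod M N (P : projres M) i : is_submod (ext_cobound N P i).
Proof.
case: i => [|i].
  by split=> [//|f g f0 g0 x|k f f0 x]; rewrite fctE ?f0 ?g0 ?addr0 ?scaler0.
have [C0 CD CZ] := cochain_submod (prP P i) N.
split=> [|f g /coboundSE[u cu ->] /coboundSE[v cv ->]|k f /coboundSE[u cu ->]];
  apply/coboundSE.
- by exists 0.
- by exists (u + v) => //; apply: CD.
- by exists (k *: u) => //; apply: CZ.
Qed.

End Cochain.

#[local] Hint Extern 0 (is_submod _) => solve [exact: submod0
  | exact: cochain_submod | exact: cocycle_submod | exact: cobound_submod] : core.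

(** * Independence of Ext from the resolution, and a formula for the Euler form *)

Section Ext.
Variables (K : fieldType) (A : pzAlgType K).
Implicit Types (M N P : lmodType A).

Lemma cobound_cocycle M N (P : projres M) i :
  (ext_cobound N P i `<=` ext_cocycle N P i)%classic.
Proof.
case: i => [f f0|i f /coboundSE[g cg ->]]; apply/cocycleE; split.
- have -> : f = 0 by apply/funext.
  by have [] := cochain_submod (prP P 0) N.
- by move=> y; rewrite f0.
- by move=> a x y; rewrite /= linearP; apply: cg.
- move=> y; rewrite /= prd_prd.
  by have [h hE] := linear_pack cg; rewrite -hE linear0.
Qed.

Section Comparison.
Variables (M N : lmodType A).

Lemma cocycle_lift (P Q : projres M) (f : forall i, {linear prP P i -> prP Q i}) i z :
  (forall i x, prd Q i (f i.+1 x) = f i (prd P i x)) ->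
  ext_cocycle N Q i z -> ext_cocycle N P i (z \o f i).
Proof.
move=> fS /cocycleE[cz zd]; apply/cocycleE; split=> [a x y|y] /=.
  by rewrite linearP; apply: cz.
by rewrite -fS zd.
Qed.

Lemma cobound_lift (P Q : projres M) (f : forall i, {linear prP P i -> prP Q i}) i z :
  (forall i x, prd Q i (f i.+1 x) = f i (prd P i x)) ->
  ext_cobound N Q i z -> ext_cobound N P i (z \o f i).
Proof.
move=> fS; case: i z => [z z0 x /=|i z /coboundSE[u cu ->]]; first by rewrite z0.
apply/coboundSE; exists (u \o f i) => [a x y|]; first by rewrite /= linearP; apply: cu.
by apply/funext => x /=; rewrite fS.
Qed.

(** With s a homotopy from the identity to g, z g - z = z d s + z s d, where z d = 0; hence z g - z
    is the coboundary of z s, and is 0 in degree 0. *)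
Lemma homotopy_cobound (P : projres M) (g : forall i, {linear prP P i -> prP P i}) i z :
    (forall x, pre P (g 0%N x) = pre P x) ->
    (forall i x, prd P i (g i.+1 x) = g i (prd P i x)) ->
  ext_cocycle N P i z -> ext_cobound N P i (z - (z \o g i)).
Proof.
move=> g0 gS /cocycleE[cz zd]; have [s [s0 sS]] := chain_homotopy g0 gS.
have [h hE] := linear_pack cz.
have [BB0 BBD BBZ] := cobound_submod N P i.
rewrite -opprB -scaleN1r; apply: BBZ.
case: i z cz zd h hE BB0 BBD => [|i] z cz zd h hE _ _.
  move=> x; change (z (g 0%N x) - z x = 0).
  by rewrite -!hE -linearB -s0 hE zd.
apply/coboundSE; exists (z \o s i) => [a x y|]; first by rewrite /= linearP; apply: cz.
apply/funext => x; change (z (g i.+1 x) - z x = z (s i (prd P i x))).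
by apply/eqP; rewrite -!hE -linearB -subr_eq0 -linearB -sS hE zd.
Qed.

(** The comparison maps between P and Q are mutually inverse up to homotopy, hence inverse modulo
    coboundaries. *)
Lemma ext_transfer (P Q : projres M) i d :
  vdim (ext_cocycle N P i) (ext_cobound N P i) d <->
  vdim (ext_cocycle N Q i) (ext_cobound N Q i) d.
Proof.
have [f [f0 fS]] := chain_lift Q P idfun; have [h [h0 hS]] := chain_lift P Q idfun.
have fh0 x : pre P ((f 0%N \o h 0%N) x) = pre P x by rewrite /= f0 h0.
have hf0 x : pre Q ((h 0%N \o f 0%N) x) = pre Q x by rewrite /= h0 f0.
have fhS j x : prd P j ((f j.+1 \o h j.+1) x) = (f j \o h j) (prd P j x).
  by rewrite /= fS hS.
have hfS j x : prd Q j ((h j.+1 \o f j.+1) x) = (h j \o f j) (prd Q j x).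
  by rewrite /= hS fS.
apply: (@vdim_transfer _ _ _ (fun z : prP P i -> restr N => z \o f i)) => //.
- by move=> z; apply: cocycle_lift.
- move=> z cz; split; first exact: cobound_lift.
  move=> /(@cobound_lift P Q h i) - /(_ hS) bz.
  have := @homotopy_cobound P (fun j => f j \o h j) i z fh0 fhS cz.
  by move/submod_subr; apply.
- move=> z cz; exists (z \o h i); first exact: cocycle_lift.
  exact: (@homotopy_cobound Q (fun j => h j \o f j) i z hf0 hfS cz).
Qed.

Lemma extdimE (P : projres M) i d :
  vdim (ext_cocycle N P i) (ext_cobound N P i) d -> extdim i M N = d.
Proof.
move=> dP; apply: xget_unique => [|e [Q /(ext_transfer P Q)]]; first by exists P.
by move/vdim_uniq; apply.
Qed.

(** The resolution Q of length d has only the zero cochain in degree i, and the comparison carries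
    this over to P. *)
Lemma ext_vanish d (P : projres M) i : gldim_le A d -> (d < i)%N ->
  (ext_cocycle N P i `<=` ext_cobound N P i)%classic.
Proof.
move=> /(_ M)[Q Q0] di; apply: vdim0_sub; apply/(ext_transfer P Q).
apply: vdim0 => // z /cocycleE[/linear_pack[h hE] _].
have -> : z = 0 by apply/funext => x; rewrite -hE (Q0 _ di x) linear0.
by have [] := cobound_submod N Q i.
Qed.

(** Let c, z, b, h be the dimensions of cochains, cocycles, coboundaries and cohomology. Then c_i =
    z_i + b_(i+1), z_i = b_i + h_i, b_0 = 0, and h_i = 0 for i > 3. The alternating sum of c_0, ...,
    c_3 telescopes up to b_4, which equals z_4. *)
Lemma euler_formula (P : projres M) (c : nat -> nat) : gldim_le A 3 ->
    (forall i, vdim (@cochain _ _ (prP P i) N) [set 0]%classic (c i)) ->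
  exists2 z, vdim (ext_cocycle N P 4) [set 0]%classic z
    & euler M N = \sum_(i < 4) (-1) ^+ i * (c i)%:Z + z%:Z.
Proof.
move=> gl cP.
have ZC i : (ext_cocycle N P i `<=` @cochain _ _ (prP P i) N)%classic.
  by move=> z /cocycleE[].
have /choice[zz zP] : forall i, exists a, vdim (ext_cocycle N P i) [set 0]%classic a.
  move=> i; apply: vdim_sub_ex (cP i) => //; exact: ZC.
have /choice[bb bP] : forall i, exists a, vdim (ext_cobound N P i) [set 0]%classic a.
  move=> i; apply: vdim_sub_ex (zP i) => //; exact: cobound_cocycle.
have /choice[hh hP] : forall i, exists a,
    vdim (ext_cocycle N P i) (ext_cobound N P i) a.
  move=> i; apply: vdim_sub_ex (zP i) => //.
  by move=> _ ->; case: (cobound_submod N P i).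
have zE i : zz i = (bb i + hh i)%N.
  apply: (vdim_uniq _ _ (zP i)) => //.
  apply: vdim_add (bP i) (hP i) => //.
  - exact: cobound_cocycle.
  - by move=> _ ->; case: (cobound_submod N P i).
have cE i : c i = (zz i + bb i.+1)%N.
  apply: (vdim_uniq _ _ (cP i)) => //.
  apply: (@vdim_ses _ _ _ _ idfun (fun f : prP P i -> restr N => f \o prd P i))
    (zP i) (bP i.+1) => //.
  - by move=> f /ZC.
  - by move=> f cf; apply/coboundSE; exists f.
  - by move=> f /cocycleE[_ fd]; apply/funext.
  - move=> f cf fd; exists f => //; apply/cocycleE; split=> // y.
    exact: (congr1 (@^~ y) fd).
  - by move=> f /coboundSE[g cg ->]; exists g.
have b0 : bb 0%N = 0%N.
  apply: (vdim_uniq _ _ (bP 0%N)) => //.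
  by apply: vdim0 => // f f0; apply/funext.
have h4 i : (3 < i)%N -> hh i = 0%N.
  move=> i3; apply: (vdim_uniq _ _ (hP i)) => //.
  by apply: vdim0 => //; apply: ext_vanish gl i3.
exists (zz 4); first exact: zP.
rewrite /euler (eq_fsbigr (fun i => (-1) ^+ i * (hh i)%:Z)); last first.
  by move=> i _; rewrite (extdimE (hP i)).
(* Only the degrees below 4 contribute to the sum over all degrees. *)
rewrite -(fsbig_widen `I_4) //=; last first.
  by move=> i [_ /negP]; rewrite -leqNgt => /h4 /= ->; rewrite mulr0.
rewrite -fsbig_ord !big_ord_recl !big_ord0 /= /bump /= !cE !zE b0 (h4 4%N) //.
rewrite !PoszD; ring.
Qed.
End Comparison.
End Ext.

(** * Additivity of the Euler form *)

Section Generation.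
Variable A : pzRingType.
Implicit Types M N P : lmodType A.

(** Generation as minimality among submodules, so that images and concatenations are handled without
    coefficients. *)
Definition spans M (s : seq M) (N : set M) : Prop :=
  (forall x, x \in s -> N x) /\
  forall N' : set M, is_submod N' -> (forall x, x \in s -> N' x) -> (N `<=` N')%classic.

Lemma fgenP M (N : set M) : is_submod N -> fgen N <-> exists s, spans s N.
Proof.
move=> sN; split=> [[m [x Nx]]|[s [Ns minN]]].
  exists (codom x); split=> [y /codomP[i ->]|N' sN' N'x].
    rewrite Nx; exists (fun j => (j == i)%:R).
    rewrite (bigD1 i) //= eqxx scale1r big1 ?addr0 // => j /negbTE ->.
    by rewrite scale0r.
  rewrite Nx => _ [a ->]; apply: submod_sum => // i _.
  by have [_ _] := sN'; apply; apply: N'x; apply: codom_f.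
exists (size s), (fun i => s`_i); apply/seteqP; split; last first.
  move=> _ [a ->]; apply: submod_sum => // i _.
  by have [_ _] := sN; apply; apply: Ns; apply: mem_nth.
apply: minN => [|x xs].
  split=> [|_ _ [a ->] [b ->]|k _ [a ->]].
  - by exists (fun=> 0); rewrite big1 // => i _; rewrite scale0r.
  - exists (fun i => a i + b i); rewrite -big_split /=.
    by apply: eq_bigr => i _; rewrite scalerDl.
  - exists (fun i => k * a i); rewrite scaler_sumr.
    by apply: eq_bigr => i _; rewrite scalerA.
have ltx : (index x s < size s)%N by rewrite index_mem.
exists (fun j => (j == Ordinal ltx)%:R).
rewrite (bigD1 (Ordinal ltx)) //= eqxx scale1r nth_index // big1 ?addr0 //.
by move=> j /negbTE ->; rewrite scale0r.
Qed.

Lemma free_linear M m (x : 'I_m -> M) :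
  linear (fun c : 'rV[A]_m => \sum_i c 0 i *: x i).
Proof.
move=> a c d; rewrite scaler_sumr -big_split /=; apply: eq_bigr => i _.
by rewrite !mxE scalerDl scalerA.
Qed.

Lemma fgen_surj M N (f : {linear M -> N}) : (forall y, exists x, f x = y) ->
  fgen [set: M] -> fgen [set: N].
Proof.
move=> fsurj /(fgenP (submodT M))[s [_ minM]]; apply/fgenP => //.
exists (map f s); split=> // N' sN' N's y _; have [x <-] := fsurj y.
apply: (minM _ (preim_is_submod f sN')) => // z zs.
by apply: N's; apply: map_f.
Qed.

Lemma fgen_cover M (N : set M) : fgen N ->
  exists m (f : {linear 'rV[A]_m -> M}), forall y, N y <-> exists x, f x = y.
Proof.
move=> [m [x ->]]; have [f fE] := linear_pack (free_linear x).
exists m, f => y; split=> [[a ->]|[c <-]].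
  exists (\row_i a i); rewrite fE; apply: eq_bigr => i _; by rewrite mxE.
by exists (fun i => c 0 i); rewrite fE.
Qed.

Lemma fgen_free m : fgen [set: 'rV[A]_m].
Proof.
exists m, (fun i => delta_mx 0 i); apply/seteqP; split=> // c _.
by exists (fun i => c 0 i); rewrite -row_sum_delta.
Qed.

Lemma projmod_free m : projmod 'rV[A]_m.
Proof.
move=> U V g f gs.
have /choice[u uE] : forall i : 'I_m, exists u, g u = f (delta_mx 0 i).
  by move=> i; apply: gs.
have [h hE] := linear_pack (free_linear u); exists h => c.
rewrite hE linear_sum [in RHS](row_sum_delta c) linear_sum.
by apply: eq_bigr => i _; rewrite !linearZ_LR uE.
Qed.

(** Induction on m: the first coordinates of N form a left ideal, and the vectors of N with first
    coordinate 0 a submodule of a smaller free module. Generators of the ideal, lifted to N, and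
    generators of this submodule generate N. *)
Lemma noetherian_free m (N : submod 'rV[A]_m) :
  (forall I : submod A^o, fgen I) -> fgen N.
Proof.
move=> noeth; elim: m => [|m IH] in N *.
  apply/fgenP; first exact: smP; exists [::]; split=> // N' [N'0 _ _] _ x _.
  by have -> : x = 0 by apply/rowP; case.
have sN := smP N; have [N0 ND NZ] := sN.
pose first (N' : set 'rV[A]_(1 + m)) : set A^o :=
  [set a | exists2 x, N' x & x 0 0 = a]%classic.
have sfirst (N' : set 'rV[A]_(1 + m)) : is_submod N' -> is_submod (first N').
  move=> [N'0 N'D N'Z]; split=> [|_ _ [x Nx <-] [y Ny <-]|a _ [x Nx <-]].
  - by exists 0 => //; rewrite mxE.
  - by exists (x + y); [apply: N'D | rewrite mxE].
  - by exists (a *: x); [apply: N'Z | rewrite mxE].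
pose rest (N' : set 'rV[A]_(1 + m)) : set 'rV[A]_m :=
  [set y | N' (row_mx (0 : 'rV_1) y)]%classic.
have srest (N' : set 'rV[A]_(1 + m)) : is_submod N' -> is_submod (rest N').
  move=> [N'0 N'D N'Z]; split=> [|x y Nx Ny|a x Nx]; rewrite /rest /=.
  - by rewrite row_mx0.
  - by rewrite -[0]addr0 -add_row_mx; apply: N'D.
  - by rewrite -[0](scaler0 _ a) -scale_row_mx; apply: N'Z.
have /(fgenP (sfirst N sN))[s [sI minI]] := noeth (Submod (sfirst N sN)).
have /(fgenP (srest N sN))[t [tR minR]] := IH (Submod (srest N sN)).
(* The lift l is made total by the value 0 outside the ideal of first coordinates. *)
have /choice[l lP] : forall a : A^o, exists x : 'rV[A]_(1 + m),
    first N a -> smcar N x /\ x 0 0 = a.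
  move=> a; have [[x Nx xa]|na] := pselect (first N a); first by exists x.
  by exists 0 => /na.
apply/fgenP => //; exists (map l s ++ map (row_mx (0 : 'rV_1)) t); split.
  move=> x; rewrite mem_cat => /orP[] /mapP[a ain ->]; first by case: (lP a (sI a ain)).
  exact: tR.
move=> N' sN' N'g x Nx.
(* The first coordinates of the intersection of N and N' contain the generators of the ideal. So
   some y in it has the same first coordinate as x, and x - y lies in [rest]. *)
pose NN : set 'rV[A]_(1 + m) := [set x | smcar N x /\ N' x]%classic.
have sNN : is_submod NN.
  have [N'0 N'D N'Z] := sN'; split=> [|u v [Nu N'u] [Nv N'v]|a u [Nu N'u]] //; split.
  - exact: ND.
  - exact: N'D.
  - exact: NZ.
  - exact: N'Z.
have [y [Ny N'y] yx] : first NN (x 0 0).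
  apply: minI; [exact: sfirst | | by exists x].
  move=> a ain; have [Nl la] := lP a (sI a ain); exists (l a) => //; split=> //.
  by apply: N'g; rewrite mem_cat map_f.
apply: (submod_subr sN') N'y.
have xyE : x - y = row_mx (0 : 'rV_1) (rsubmx (x - y : 'rV_(1 + m))).
  rewrite -[LHS](@hsubmxK _ _ 1 m) (_ : lsubmx _ = 0) //; apply/rowP => i.
  by rewrite !mxE ord1 (_ : lshift m 0 = 0) ?yx ?subrr //; apply: val_inj.
rewrite xyE; apply: (minR (rest N')); first exact: srest.
  by move=> z zt; apply: N'g; rewrite mem_cat map_f ?orbT.
by rewrite /rest /= -xyE; apply: submodB.
Qed.

(** Each kernel is finitely generated by [noetherian_free], hence covered by the next free
    module. *)
Lemma free_resolution M : (forall I : submod A^o, fgen I) -> fgen [set: M] ->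
  exists P : projres M, forall i, fgen [set: prP P i].
Proof.
move=> noeth /fgen_cover[m0 [e eE]].
pose X := {m : nat & submod 'rV[A]_m}.
(* A state is a free module with the kernel still to be covered: d maps onto the kernel stored in x,
   and its own kernel is stored in y. *)
pose R (x y : X) := exists d : {linear 'rV[A]_(tag y) -> 'rV[A]_(tag x)},
  (forall z, smcar (tagged x) z <-> exists u, d u = z) /\
  (forall u, smcar (tagged y) u <-> d u = 0).
have [|F [F0 FS]] := @dep_choice (fun=> X) (fun=> R)
  (Tagged (fun m => submod 'rV[A]_m) (ker_submod e)).
  move=> _ [m N]; have /fgen_cover[m' [d dE]] := noetherian_free N noeth.
  by exists (Tagged (fun m => submod 'rV[A]_m) (ker_submod d)), d.
have [d dP] : exists d : forall i, {linear 'rV[A]_(tag (F i.+1)) -> 'rV[A]_(tag (F i))},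
    forall i, (forall z, smcar (tagged (F i)) z <-> exists u, d i u = z) /\
  (forall u, smcar (tagged (F i.+1)) u <-> d i u = 0).
  by exists (fun i => projT1 (cid (FS i))) => i; apply: projT2 (cid (FS i)).
have [e' [e'P e'k]] : exists e' : {linear 'rV[A]_(tag (F 0%N)) -> M},
    (forall m, exists x, e' x = m) /\ forall x, smcar (tagged (F 0%N)) x <-> e' x = 0.
  by rewrite F0; exists e; split=> // m; apply/eE.
unshelve eexists (@Projres A M (fun i => 'rV[A]_(tag (F i))) d e' _ e'P _ _).
- by move=> i; apply: projmod_free.
- by move=> x; rewrite -e'k; apply: (dP 0%N).1.
- by move=> i x; rewrite -(dP i).2; apply: (dP i.+1).1.
by move=> i; apply: fgen_free.
Qed.

Lemma projmod_prod U V : projmod U -> projmod V -> projmod ((U * V)%type : lmodType A).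
Proof.
move=> pU pV X Y p q ps.
have [q1 q1E] : exists q1 : {linear U -> Y}, forall u, q1 u = q (u, 0).
  apply: linear_pack => a x y; rewrite -linearP; congr (q (_, _)).
  by rewrite /= scaler0 addr0.
have [q2 q2E] : exists q2 : {linear V -> Y}, forall v, q2 v = q (0, v).
  apply: linear_pack => a x y; rewrite -linearP; congr (q (_, _)).
  by rewrite /= scaler0 addr0.
have [h1 h1E] := pU _ _ p q1 ps; have [h2 h2E] := pV _ _ p q2 ps.
have [h hE] : exists h : {linear (U * V)%type -> X}, forall x, h x = h1 x.1 + h2 x.2.
  by apply: linear_pack => a x y /=; rewrite !linearP scalerDr addrACA.
exists h => -[u v]; rewrite hE linearD h1E h2E q1E q2E -linearD; congr (q (_, _)).
  exact: addr0.
exact: add0r.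
Qed.

Section Horseshoe.
Variables (L M N : lmodType A) (f : {linear L -> M}) (g : {linear M -> N}).
Hypothesis fg : mod_ses f g.
Variables (P : projres L) (Q : projres N).

(* The differential of P (+) Q is (x, y) |-> (d x + t y, d y), where the maps
   t_i : Q_(i+1) -> P_i are lifted one after the other. *)
Lemma horseshoe : exists (R : projres M)
    (ia : forall i, {linear prP P i -> prP R i})
    (pb : forall i, {linear prP R i -> prP Q i})
    (ra : forall i, {linear prP R i -> prP P i})
    (sb : forall i, {linear prP Q i -> prP R i}),
  [/\ forall i x, ra i (ia i x) = x, forall i x, pb i (ia i x) = 0,
      forall i y, pb i (sb i y) = y,
      forall i z, ia i (ra i z) + sb i (pb i z) = z
    & (forall i x, prd R i (ia i.+1 x) = ia i (prd P i x)) /\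
      (forall i z, pb i (prd R i z) = prd Q i (pb i.+1 z))].
Proof.
have [finj gsurj gf] := fg.
have f0 x : f x = 0 -> x = 0 by move=> fx; apply: finj; rewrite fx linear0.
have [s sE] : exists s : {linear prP Q 0 -> M}, forall y, g (s y) = pre Q y.
  exact: (@pr_proj _ _ Q 0 _ _ g (pre Q) gsurj).
have [t0 t0E] : exists t0 : {linear prP Q 1 -> prP P 0},
    forall y, (f \o pre P) (t0 y) = (\- s \o prd Q 0) y.
  apply: proj_lift => [|y]; first exact: pr_proj.
  have /gf[l lE] : g (- s (prd Q 0 y)) = 0 by rewrite linearN sE pre_prd oppr0.
  by have [x xE] := pr_surj P l; exists x; rewrite /= xE lE.
(* The differential of the sum squares to zero when d t_(i+1) = - t_i d; the stored condition says
   that this can be solved for t_(i+1). *)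
pose X i := {t : {linear prP Q i.+1 -> prP P i} |
  forall y, exists x, prd P i x = - t (prd Q i.+1 y)}.
have i0 y : exists x, prd P 0 x = - t0 (prd Q 1 y).
  apply/pr_exact0; rewrite linearN; apply/eqP; rewrite oppr_eq0; apply/eqP/f0.
  by have := t0E (prd Q 1 y); rewrite /= => ->; rewrite prd_prd linear0 oppr0.
have [|F [F0 FS]] := @dep_choice X (fun i t u =>
    forall y, prd P i (sval u y) = - sval t (prd Q i.+1 y)) (exist _ t0 i0).
  move=> i [t ti] /=.
  have [|u uE] := @proj_lift _ _ _ _ (prd P i) (\- t \o prd Q i.+1)
    (@pr_proj _ _ Q i.+2).
    exact: ti.
  have ui y : exists x, prd P i.+1 x = - u (prd Q i.+2 y).
    apply/pr_exactS; rewrite linearN uE /= prd_prd linear0 !oppr0 //.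
  by exists (exist _ u ui).
pose t i : {linear prP Q i.+1 -> prP P i} := sval (F i).
have t0' y : f (pre P (t 0%N y)) = - s (prd Q 0 y) by rewrite /t F0; apply: t0E.
have tS i y : prd P i (t i.+1 y) = - t i (prd Q i.+1 y) by apply: FS.
pose RR i : lmodType A := (prP P i * prP Q i)%type.
have lD i : linear (fun z : RR i.+1 => (prd P i z.1 + t i z.2, prd Q i z.2) : RR i).
  move=> a x y; rewrite !linearP; congr (_, _) => /=.
  by rewrite scalerDr addrACA.
have le : linear (fun z : RR 0%N => f (pre P z.1) + s z.2).
  by move=> a x y; rewrite !linearP scalerDr addrACA.
have lin1 i : linear (fun x : prP P i => (x, 0) : RR i).
  by move=> a x y; congr (_, _); rewrite /= scaler0 addr0.
have lin2 i : linear (fun y : prP Q i => (0, y) : RR i).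
  by move=> a x y; congr (_, _); rewrite /= scaler0 addr0.
have lfst i : linear (fun z : RR i => z.1) by [].
have lsnd i : linear (fun z : RR i => z.2) by [].
have es m : exists z : RR 0%N, f (pre P z.1) + s z.2 = m.
  have [y yE] := pr_surj Q (g m).
  have /gf[l lE] : g (m - s y) = 0 by rewrite linearB sE yE subrr.
  by have [x xE] := pr_surj P l; exists (x, y); rewrite /= xE lE subrK.
have gfP x : g (f (pre P x)) = 0 by apply/gf; exists (pre P x).
have e0 (z : RR 0%N) : f (pre P z.1) + s z.2 = 0 <->
    exists w : RR 1%N, (prd P 0 w.1 + t 0%N w.2, prd Q 0 w.2) = z.
  case: z => x y; split=> /= [xy0|[[x' y'] /= [<- <-]]]; last first.
    by rewrite linearD pre_prd add0r t0' addNr.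
  have /pr_exact0[y' y'E] : pre Q y = 0.
    by rewrite -sE -(linear0 g) -xy0 linearD gfP add0r.
  (* Once y = d y', the remaining x - t y' is killed by the augmentation of P. *)
  have /pr_exact0[x' x'E] : pre P (x - t 0%N y') = 0.
    by apply: f0; rewrite !linearB t0' y'E opprK; exact: xy0.
  by exists (x', y'); rewrite /= x'E y'E subrK.
have eS i (z : RR i.+1) : (prd P i z.1 + t i z.2, prd Q i z.2) = 0 :> RR i <->
    exists w : RR i.+2, (prd P i.+1 w.1 + t i.+1 w.2, prd Q i.+1 w.2) = z.
  case: z => x y; split=> /= [[xy0 dy0]|[[x' y'] /= [<- <-]]]; last first.
    by rewrite linearD !prd_prd tS add0r addNr.
  have /pr_exactS[y' y'E] := dy0.
  have /pr_exactS[x' x'E] : prd P i (x - t i.+1 y') = 0.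
    by rewrite linearB tS y'E opprK.
  by exists (x', y'); rewrite /= x'E y'E subrK.
have pRR i : projmod (RR i) by apply: projmod_prod; apply: pr_proj.
exists (@Projres A M RR (fun i => lin_pack (lD i)) (lin_pack le) pRR es e0 eS).
exists (fun i => lin_pack (lin1 i)), (fun i => lin_pack (lsnd i)).
exists (fun i => lin_pack (lfst i)), (fun i => lin_pack (lin2 i)).
split=> //=.
- by move=> i [x y]; congr (_, _); rewrite /= ?addr0 ?add0r.
- by split=> // i x; congr (_, _); rewrite /= linear0 ?addr0.
Qed.
End Horseshoe.
End Generation.

(** * Additivity of the Euler form in either variable *)

Section EulerAdditivity.
Variables (K : fieldType) (A : pzAlgType K).
Implicit Types (L M N X : lmodType A).
Hypothesis gl : gldim_le A 3.
Hypothesis noeth : forall I : submod A^o, fgen I.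

Lemma findim_funspace (V : lmodType K) m : findim V -> findim ('I_m -> V).
Proof.
move=> [d dV]; have [y [_ yV _]] := vdim_indep (submodT V) dV.
pose x (kl : 'I_m * 'I_d) : 'I_m -> V := fun j => if j == kl.1 then y kl.2 else 0.
apply: (@vdim_ex_fin K _ _ _ _ x) => // z _.
have /choice[c cP] : forall j, exists c, z j - lcomb c y = 0.
  by move=> j; apply: yV.
exists (fun kl => c kl.1 0 kl.2).
apply/eqP; rewrite subr_eq0; apply/eqP/funext => j; rewrite fct_sumE.
rewrite -[RHS]/(\sum_(kl : 'I_m * 'I_d)
  c kl.1 0 kl.2 *: (if j == kl.1 then y kl.2 else 0)).
rewrite -(pair_bigA _ (fun k l => c k 0 l *: (if j == k then y l else 0))) /=.
rewrite (bigD1 j) //= [X in _ + X]big1 ?addr0; last first.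
  move=> k kj; rewrite big1 // => l _; by rewrite eq_sym (negbTE kj) scaler0.
have /eqP := cP j; rewrite subr_eq0 => /eqP ->.
by apply: eq_bigr => l _; rewrite eqxx.
Qed.

(** A linear map is determined by its values on m generators, so the cochains embed in N^m. *)
Lemma cochain_findim (P N : lmodType A) : fgen [set: P] -> findim (restr N) ->
  exists c, vdim (@cochain _ _ P N) [set 0]%classic c.
Proof.
move=> [m [x Px]] /(@findim_funspace _ m)[d dV].
pose phi (f : P -> restr N) : 'I_m -> restr N := fun i => f (x i).
have lphi : linear phi by [].
have phi0 f : cochain f -> phi f = 0 -> f = 0.
  move=> /linear_pack[h hE] f0; apply/funext => p; rewrite -hE.
  have : [set: P]%classic p by []; rewrite Px => -[a ->].
  rewrite linear_sum big1 // => i _; rewrite linearZ_LR hE.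
  by have := congr1 (@^~ i) f0; rewrite /phi /= => ->; rewrite scaler0.
have sW : is_submod [set phi f | f in @cochain _ _ P N]%classic.
  have [C0 CD CZ] := @cochain_submod _ _ P N.
  split=> [|_ _ [f cf <-] [h ch <-]|a _ [f cf <-]].
  - by exists 0.
  - by exists (f + h) => //; apply: CD.
  - by exists (a *: f) => //; apply: CZ.
have [c cP] := vdim_sub_ex (submodT _) sW (submod0 _) (fun _ _ => I) (fun _ H => H) dV.
exists c; apply: ((@vdim_transfer _ _ _ phi _ _ _ _ lphi _ _ _ _ _ _ _ c).2 cP) => //.
- by move=> f cf; exists f.
- by move=> f cf; split=> [->|/(phi0 _ cf)].
- by move=> _ [f cf <-]; exists f => //=; rewrite subrr.
Qed.

(** Common core of both additivities: f and g are maps of cochain complexes, short exact in each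
    degree. The c_i add up by exactness, and so does z_4, because the 4-cocycles form a short exact
    sequence too. *)
Lemma euler_ses (M1 M2 M3 N1 N2 N3 : lmodType A) (P1 : projres M1) (P2 : projres M2)
    (P3 : projres M3)
    (f : forall i, (prP P1 i -> restr N1) -> (prP P2 i -> restr N2))
    (g : forall i, (prP P2 i -> restr N2) -> (prP P3 i -> restr N3)) :
    (forall i, linear (f i)) -> (forall i, linear (g i)) ->
    (forall i u, f i.+1 (u \o prd P1 i) = f i u \o prd P2 i) ->
    (forall i u, g i.+1 (u \o prd P2 i) = g i u \o prd P3 i) ->
    (forall i u, cochain u -> cochain (f i u)) ->
    (forall i u, cochain u -> cochain (g i u)) ->
    (forall i u, cochain u -> f i u = 0 -> u = 0) ->
    (forall i u, cochain u -> g i (f i u) = 0) ->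
    (forall i v, cochain v -> g i v = 0 -> exists2 u, cochain u & f i u = v) ->
    (forall i w, cochain w -> exists2 v, cochain v & g i v = w) ->
    (forall i, exists c, vdim (@cochain _ _ (prP P1 i) N1) [set 0]%classic c) ->
    (forall i, exists c, vdim (@cochain _ _ (prP P3 i) N3) [set 0]%classic c) ->
  euler M2 N2 = euler M1 N1 + euler M3 N3.
Proof.
move=> lf lg fd gd cf cg fi gf ex gs /choice[c1 c1P] /choice[c3 c3P].
have f0 i : f i 0 = 0 := lin0 (lf i).
have g0 i : g i 0 = 0 := lin0 (lg i).
have c2P i : vdim (@cochain _ _ (prP P2 i) N2) [set 0]%classic (c1 i + c3 i).
  exact: (vdim_ses (lf i) (lg i) _ _ _ (@fi i) (@cf i) (@cg i) (@gf i) (@ex i) (@gs i)).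
have [z1 z1P e1] := euler_formula gl c1P.
have [z2 z2P e2] := euler_formula gl c2P.
have [z3 z3P e3] := euler_formula gl c3P.
have zE : z2 = (z1 + z3)%N.
  apply: (vdim_uniq _ _ z2P) => //.
  apply: (vdim_ses (lf 4) (lg 4)) z1P z3P => //.
  - by move=> u /cocycleE[cu _]; apply: fi.
  - move=> u /cocycleE[cu ud]; apply/cocycleE; split; first exact: cf.
    move=> y; have := fd 4 u; rewrite (_ : u \o _ = 0); last exact/funext.
    by rewrite f0 => /(congr1 (@^~ y)) /= <-.
  - move=> u /cocycleE[cu ud]; apply/cocycleE; split; first exact: cg.
    move=> y; have := gd 4 u; rewrite (_ : u \o _ = 0); last exact/funext.
    by rewrite g0 => /(congr1 (@^~ y)) /= <-.
  - by move=> u /cocycleE[cu _]; apply: gf.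
  - move=> v /cocycleE[cv vd] /(ex 4 _ cv)[u cu uv]; exists u => //.
    apply/cocycleE; split=> // y.
    (* f is injective in degree 5 and sends u d to v d = 0, so u is a cocycle as v is. *)
    have /fi : cochain (u \o prd P1 4).
      by move=> a x x'; rewrite /= linearP; apply: cu.
    rewrite fd uv => /(_ _)/(congr1 (@^~ y)); apply.
    by apply/funext => x; apply: vd.
  (* Z^4 -> Z^4 is onto: a cocycle w' o d of the third complex is hit by v o d,
     where v is a cochain over w'. *)
  - move=> w /(ext_vanish gl (isT : 3 < 4)%N)/coboundSE[w' cw' ->].
    have [v cv vE] := gs 3 _ cw'; exists (v \o prd P2 3).
      by apply: cobound_cocycle; apply/coboundSE; exists v.
    by rewrite gd vE.
rewrite e1 e2 e3 zE PoszD addrACA -big_split /=; congr (_ + _).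
by apply: eq_bigr => i _; rewrite PoszD mulrDr.
Qed.

(** Hom(P_i, -) is exact for each term P_i of a resolution of X. *)
Lemma euler_add_r X L M N (f : {linear L -> M}) (g : {linear M -> N}) :
    fgen [set: X] -> findim (restr L) -> findim (restr N) -> mod_ses f g ->
  euler X M = euler X L + euler X N.
Proof.
move=> fX fL fN [finj gsurj gf]; have [P fP] := free_resolution noeth fX.
have f0 x : f x = 0 -> x = 0 by move=> fx; apply: finj; rewrite fx linear0.
apply: (@euler_ses X X X L M N P P P (fun i u => f \o u) (fun i u => g \o u)) => //.
- by move=> i; apply: postcomp_linear.
- by move=> i; apply: postcomp_linear.
- by move=> i u cu a x y; rewrite /= cu linearP.
- by move=> i u cu a x y; rewrite /= cu linearP.
- by move=> i u cu fu; apply/funext => x; apply: f0; apply: (congr1 (@^~ x) fu).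
- by move=> i u cu; apply/funext => x; apply/gf; exists (u x).
- move=> i v /linear_pack[v' v'E] gv.
  have [|u uE] := @proj_lift _ _ _ _ f v' (@pr_proj _ _ P i).
    by move=> p; apply/gf; rewrite v'E; apply: (congr1 (@^~ p) gv).
  exists u; first exact: linearP.
  by apply/funext => x; rewrite /= uE v'E.
- move=> i w /linear_pack[w' w'E].
  have [v vE] := @pr_proj _ _ P i _ _ g w' gsurj.
  exists v; first exact: linearP.
  by apply/funext => x; rewrite /= vE w'E.
- by move=> i; apply: cochain_findim.
- by move=> i; apply: cochain_findim.
Qed.

(** The horseshoe resolution of M is split in each degree, so Hom(-, X) keeps it exact;
    contravariance puts the complex of N first. *)
Lemma euler_add_l X L M N (f : {linear L -> M}) (g : {linear M -> N}) :
    findim (restr X) -> fgen [set: L] -> fgen [set: N] -> mod_ses f g ->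
  euler M X = euler L X + euler N X.
Proof.
move=> fX fL fN ses; have [P fP] := free_resolution noeth fL.
have [Q fQ] := free_resolution noeth fN.
have [R [ia [pb [ra [sb [ri pi ps isum [iS pS]]]]]]] := horseshoe ses P Q.
rewrite addrC; apply: (@euler_ses N M L X X X Q R P
  (fun i u => u \o pb i) (fun i u => u \o ia i)) => //.
- by move=> i u; apply/funext => x; rewrite /= pS.
- by move=> i u; apply/funext => x; rewrite /= iS.
- by move=> i u cu a x y; rewrite /= linearP cu.
- by move=> i u cu a x y; rewrite /= linearP cu.
- move=> i u cu pu; apply/funext => x; rewrite -(ps i x).
  exact: (congr1 (@^~ (sb i x)) pu).
- move=> i u /linear_pack[v vE]; apply/funext => x; rewrite /= pi -vE.
  exact: linear0.
- move=> i v cv vi; exists (v \o sb i) => [a x y|]; first by rewrite /= linearP cv.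
  have [v' v'E] := linear_pack cv; apply/funext => x.
  rewrite /= -!v'E -[in RHS](isum i x) linearD.
  have -> : v' (ia i (ra i x)) = 0 by rewrite v'E; apply: (congr1 (@^~ (ra i x)) vi).
  by rewrite add0r.
- move=> i w cw; exists (w \o ra i) => [a x y|]; first by rewrite /= linearP cw.
  by apply/funext => x; rewrite /= ri.
- by move=> i; apply: cochain_findim.
- by move=> i; apply: cochain_findim.
Qed.

End EulerAdditivity.

(** * Exact categories and the functor Hom(T, -) *)

Section LinearCategoryTheory.
Variables (K : fieldType) (E : linCat K).
Implicit Types X Y Z W : E.

Lemma compDl X Y Z (g g' : Mor Y Z) (f : Mor X Y) : (g + g') ∘ f = g ∘ f + g' ∘ f.
Proof. by have := comp_linl 1 g g' f; rewrite !scale1r. Qed.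

Lemma compDr X Y Z (g : Mor Y Z) (f f' : Mor X Y) : g ∘ (f + f') = g ∘ f + g ∘ f'.
Proof. by have := comp_linr 1 g f f'; rewrite !scale1r. Qed.

Lemma comp0l X Y Z (f : Mor X Y) : (0 : Mor Y Z) ∘ f = 0.
Proof. by apply: (addrI (0 ∘ f)); rewrite -compDl !addr0. Qed.

Lemma comp0r X Y Z (g : Mor Y Z) : g ∘ (0 : Mor X Y) = 0.
Proof. by apply: (addrI (g ∘ 0)); rewrite -compDr !addr0. Qed.

Lemma compZl X Y Z k (g : Mor Y Z) (f : Mor X Y) : (k *: g) ∘ f = k *: (g ∘ f).
Proof. by have := comp_linl k g 0 f; rewrite comp0l !addr0. Qed.

Lemma compZr X Y Z k (g : Mor Y Z) (f : Mor X Y) : g ∘ (k *: f) = k *: (g ∘ f).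
Proof. by have := comp_linr k g f 0; rewrite comp0r !addr0. Qed.

Lemma compBl X Y Z (g g' : Mor Y Z) (f : Mor X Y) : (g - g') ∘ f = g ∘ f - g' ∘ f.
Proof. by rewrite compDl -scaleN1r compZl scaleN1r. Qed.

Lemma compBr X Y Z (g : Mor Y Z) (f f' : Mor X Y) : g ∘ (f - f') = g ∘ f - g ∘ f'.
Proof. by rewrite compDr -[- f']scaleN1r compZr scaleN1r. Qed.

Lemma comp_suml X Y Z (I : Type) (s : seq I) (P : pred I) (g : I -> Mor Y Z)
    (f : Mor X Y) :
  (\sum_(i <- s | P i) g i) ∘ f = \sum_(i <- s | P i) g i ∘ f.
Proof.
apply: (big_morph (fun h => h ∘ f)); last exact: comp0l.
by move=> a b; apply: compDl.
Qed.

Lemma comp_sumr X Y Z (I : Type) (s : seq I) (P : pred I) (g : Mor Y Z)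
    (f : I -> Mor X Y) :
  g ∘ (\sum_(i <- s | P i) f i) = \sum_(i <- s | P i) g ∘ f i.
Proof.
apply: (big_morph (fun h => g ∘ h)); last exact: comp0r.
by move=> a b; apply: compDr.
Qed.

Lemma iso_comp X Y Z (g : Mor Y Z) (f : Mor X Y) : iso g -> iso f -> iso (g ∘ f).
Proof.
move=> [g' [g'g gg']] [f' [f'f ff']]; exists (f' ∘ g'); split.
  by rewrite -Defs.compA (Defs.compA g') g'g comp1m.
by rewrite -Defs.compA (Defs.compA f) ff' comp1m.
Qed.

(** Composing with the inverse u of f + g reduces to two endomorphisms whose sum is the identity. *)
Lemma local_add X (f g : Mor X X) : local_end X -> iso (f + g) -> iso f \/ iso g.
Proof.
move=> [_ loc] [u [uD Du]].
have fE (h : Mor X X) : iso (u ∘ h) -> iso h.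
  move=> uh; rewrite -[h]comp1m -Du -Defs.compA; apply: iso_comp => //.
  by exists u.
have [/fE|] := loc (u ∘ f); first by left.
by rewrite -uD compDr addrAC subrr add0r => /fE; right.
Qed.

Lemma local_sum X (I : Type) (s : seq I) (f : I -> Mor X X) : local_end X ->
  iso (\sum_(i <- s) f i) -> exists i, iso (f i).
Proof.
move=> loc; elim: s => [|i s IH]; last first.
  by rewrite big_cons => /(local_add loc)[|/IH//]; exists i.
rewrite big_nil => -[g [g0 _]]; case: loc => nz _; case: nz.
by rewrite /zero_obj -g0 comp0r.
Qed.

(** With w the inverse of g f, the endomorphism f w g of Y is idempotent. If it is invertible, it is
    the identity and f w inverts g; if 1 - f w g is invertible, it kills f, so f = 0 and X is
    zero. *)
Lemma iso_factor_local X Y (g : Mor Y X) (f : Mor X Y) :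
  ~ zero_obj X -> local_end Y -> iso (g ∘ f) -> iso g.
Proof.
move=> nzX [_ loc] [w [wgf gfw]].
have [[v [v1 v2]]|[v [v1 v2]]] := loc (f ∘ (w ∘ g)).
  have ee : f ∘ (w ∘ g) ∘ (f ∘ (w ∘ g)) = f ∘ (w ∘ g).
    rewrite -!Defs.compA; congr (f ∘ _).
    by rewrite (Defs.compA g) (Defs.compA w) Defs.compA wgf comp1m.
  have fwg : f ∘ (w ∘ g) = Idm Y by rewrite -[LHS]comp1m -v1 -Defs.compA ee v1.
  by exists (f ∘ w); rewrite -Defs.compA fwg Defs.compA gfw.
case: nzX; rewrite /zero_obj -wgf.
suff -> : f = 0 by rewrite !comp0r.
rewrite -[f]comp1m -v1 -Defs.compA compBl comp1m -!Defs.compA wgf compm1 subrr.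
exact: comp0r.
Qed.

Lemma dsum2P X Y Z : dsum2 X Y Z <->
  exists (i1 : Mor X Z) (p1 : Mor Z X) (i2 : Mor Y Z) (p2 : Mor Z Y),
  [/\ p1 ∘ i1 = Idm X, p2 ∘ i2 = Idm Y, p1 ∘ i2 = 0, p2 ∘ i1 = 0
    & i1 ∘ p1 + i2 ∘ p2 = Idm Z].
Proof.
split=> [[i [p [ip1 ip0 sumE]]]|[i1 [p1 [i2 [p2 [e1 e2 e12 e21 sumE]]]]]].
  exists (i true), (p true), (i false), (p false); split.
  - exact: (ip1 true).
  - exact: (ip1 false).
  - exact: (ip0 false true).
  - exact: (ip0 true false).
  - by rewrite -sumE big_bool.
exists (fun b : bool => if b as c return Mor (if c then X else Y) Z then i1 else i2).
exists (fun b : bool => if b as c return Mor Z (if c then X else Y) then p1 else p2).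
by split=> [[]|[] []|] //; rewrite big_bool.
Qed.

End LinearCategoryTheory.

Section HomFunctor.
Variables (K : fieldType) (E : linCat K) (T : E).

Lemma homodZE Y (a : Endop T) (f : homod T Y) :
  a *: f = (f : Mor T Y) ∘ (a : Mor T T).
Proof. by []. Qed.

Lemma homod_map_linear Y Z (p : Mor Y Z) :
  linear (fun f : homod T Y => p ∘ (f : Mor T Y) : homod T Z).
Proof.
move=> a f g; rewrite [LHS]compDr; congr (_ + _).
by rewrite !homodZE Defs.compA.
Qed.

Definition homod_map Y Z (p : Mor Y Z) : {linear homod T Y -> homod T Z} :=
  lin_pack (homod_map_linear p).

Lemma homod_scaler Y (k : K) (f : homod T Y) :
  (algmap k : Endop T) *: f = k *: (f : Mor T Y).
Proof. by rewrite homodZE [LHS]compZr compm1. Qed.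

(** Hom(T, P) is a direct summand of a free module, generated by the components T -> Y -> P. *)
Lemma in_add_fgen P : in_add T P -> fgen [set: homod T P].
Proof.
move=> [m [X' [Y [[inj [prj [_ _ sumE]]]]]]].
move=> /dsum2P[i1 [p1 [i2 [p2 [p1i1 _ _ _ _]]]]].
exists m, (fun k => p1 ∘ inj k : homod T P); apply/seteqP; split=> // f _.
exists (fun k => prj k ∘ (i1 ∘ (f : Mor T P))).
rewrite -[LHS](comp1m (f : Mor T P)) -p1i1 -[i1 in LHS]comp1m -sumE.
rewrite comp_suml comp_sumr comp_suml; apply: eq_bigr => k _.
by rewrite homodZE !Defs.compA.
Qed.

End HomFunctor.

(** * The functor Hom(T, -) on a Frobenius category *)

Section FrobeniusTheory.
Variables (K : fieldType) (E : frobCat K).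
Implicit Types X Y Z P : E.

(** P is also injective, so its injective presentation P -> I -> C splits and every T -> C lifts to
    I. *)
Lemma projective_ext0 T P (xi : Ext1 T P) : projective P -> xi = 0.
Proof.
move=> /proj_injP injP; have [u <-] := qpi_surj xi.
apply/qpi_eq0 => /=; set ip := the_injpres P in u *.
have ck := confl_cokernel (exactP E) (ip_confl ip).
have [r ri] : exists r, r ∘ ip_i ip = Idm P.
  by apply: injP; exists (ip_cosyz ip), (ip_p ip); apply: ip_confl.
have [pi0 univ] := ck.
have [s [sp _]] : exists! s, s ∘ ip_p ip = Idm _ - ip_i ip ∘ r.
  by apply: univ; rewrite compBl comp1m -Defs.compA ri compm1 subrr.
(* From s p = 1 - i r follows p s p = p, and factorisations through the cokernel p are unique. *)
have ps : ip_p ip ∘ s = Idm (ip_cosyz ip).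
  have [w [_ wu]] := univ _ (ip_p ip) pi0.
  rewrite -(wu (Idm _)) ?comp1m // (wu (ip_p ip ∘ s)) //.
  by rewrite -Defs.compA sp compBr compm1 Defs.compA pi0 comp0l subr0.
by exists (s ∘ u); rewrite Defs.compA ps comp1m.
Qed.

(** Modulo a finite basis of the stable Hom space, a morphism T -> X factors through a projective,
    hence through a fixed deflation q from a projective P; this P lies in add T, so Hom(T, P) is
    finitely generated. *)
Lemma homod_fgen T X : cluster_tilting T ->
    (exists d, vdim [set: Mor T X] (@stable0 K E T X) d) ->
  fgen [set: homod T X].
Proof.
move=> ctT [d [b [_ bP]]].
have [P [q [pP dq]]] := enough_proj X.
have : in_add T P by apply/ctT => xi; apply: projective_ext0.
move=> /in_add_fgen/(fgenP (submodT _))[s [_ sP]].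
apply/fgenP => //.
exists (codom (b : _ -> homod T X) ++ map (homod_map T q) s); split=> // N sN Ns f _.
have Nb i : N (b i) by apply: Ns; rewrite mem_cat codom_f.
have Nq (h : homod T P) : N (homod_map T q h).
  apply: (sP _ (preim_is_submod (homod_map T q) sN)) => // x xs.
  by apply: Ns; rewrite mem_cat map_f ?orbT.
have [c [[Q [a [t [pQ e]]]] _]] := bP f I.
have [h hE] := pQ _ _ q dq t.
apply: (@submod_subr _ _ N f (\sum_i c 0 i *: b i)) => //.
  by rewrite e -hE -Defs.compA; apply: Nq.
have -> : \sum_i c 0 i *: b i
    = \sum_i (algmap (c 0 i) : Endop T) *: (b i : homod T X) :> homod T X.
  by apply: eq_bigr => i _; rewrite homod_scaler.
by apply: submod_sum => // i _; have [_ _] := sN; apply.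
Qed.

Section HomConflation.
Variables (T X Y Z : E) (f : Mor X Y) (h : Mor Y Z).
Hypothesis fh : confl f h.

Lemma homod_inj (u v : Mor T X) : f ∘ u = f ∘ v -> u = v.
Proof.
move=> fuv; have [hf univ] := confl_kernel (exactP E) fh.
have [|w [_ wu]] := univ _ (f ∘ v); first by rewrite Defs.compA hf comp0l.
by rewrite -(wu u fuv) -(wu v).
Qed.

Lemma homod_exact (v : Mor T Y) : h ∘ v = 0 -> exists u, f ∘ u = v.
Proof.
have [_ univ] := confl_kernel (exactP E) fh.
by move=> /univ[u [uv _]]; exists u.
Qed.

Lemma homod_comp0 (u : Mor T X) : h ∘ (f ∘ u) = 0.
Proof. by have [hf _] := confl_kernel (exactP E) fh; rewrite Defs.compA hf comp0l. Qed.

Let C := quotmod (Submod (homod_im_submod T h)).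

(** If a factors as b a' through a projective, then u b lifts along the deflation h, so u a lies in
    the image of Hom(T, h). *)
Lemma coker_stable (a : Endop T) (x : C) : stable0 (a : Mor T T) -> a *: x = 0.
Proof.
have [u <-] := qpi_surj x; move=> [P [a' [b [pP aE]]]].
rewrite -linearZ_LR; apply/qpi_eq0 => /=.
have [k kE] := pP _ _ h (ex_intro _ X (ex_intro _ f fh)) ((u : Mor T Z) ∘ b).
by exists (k ∘ a'); rewrite homodZE aE !Defs.compA kE.
Qed.

(** The four-term exact sequence ending in C is cut at the image of Hom(T, h), presented as the
    quotient I of Hom(T, Y) by Hom(T, X). *)
Lemma euler_conflation N : gldim_le (Endop T) 3 ->
    (forall I : submod (Endop T)^o, fgen I) ->
    (forall W : E, fgen [set: homod T W]) -> findim (restr N) ->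
  euler (homod T Y) N + euler C N = euler (homod T X) N + euler (homod T Z) N.
Proof.
move=> gl noeth fg fN; set I := quotmod (im_submod (homod_map T f)).
have fgI : fgen [set: I] by apply: fgen_surj (fg Y); apply: qpi_surj.
have fgC : fgen [set: C] by apply: fgen_surj (fg Z); apply: qpi_surj.
have [|j jE] := @quot_lift _ _ (im_submod (homod_map T f)) _ (homod_map T h).
  by move=> _ [u <-]; apply: homod_comp0.
have ses1 : mod_ses (homod_map T f) (qpi (im_submod (homod_map T f))).
  split; [exact: homod_inj | exact: qpi_surj | move=> y; exact: qpi_eq0].
have ses2 : mod_ses j (qpi (Submod (homod_im_submod T h))).
  split=> [|| y].
  - move=> p q /eqP; rewrite -subr_eq0 -linearB => /eqP.
    have [y yE] := qpi_surj (p - q); rewrite -yE jE => /homod_exact[u uE].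
    apply/eqP; rewrite -subr_eq0 -yE; apply/eqP/qpi_eq0; by exists u.
  - exact: qpi_surj.
  - split=> [/qpi_eq0[u ->]|[p <-]].
      by exists (qpi _ (u : homod T Y)); rewrite jE.
    by have [u <-] := qpi_surj p; rewrite jE; apply/qpi_eq0; exists u.
have -> := euler_add_l gl noeth fN (fg X) fgI ses1.
have -> := euler_add_l gl noeth fN fgI fgC ses2.
by rewrite addrA.
Qed.

End HomConflation.
End FrobeniusTheory.

(** * Modules over the stable endomorphism algebra *)

Section LocalObjects.
Variables (K : fieldType) (E : linCat K).

Lemma comp_diag (I : finType) (Xs : I -> E) U V W (a : forall k, Mor (Xs k) W)
    (b : forall k, Mor V (Xs k)) (c : forall k, Mor (Xs k) V)
    (d : forall k, Mor U (Xs k)) :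
    (forall k, b k ∘ c k = Idm (Xs k)) -> (forall k l, k != l -> b l ∘ c k = 0) ->
  (\sum_k a k ∘ b k) ∘ (\sum_l c l ∘ d l) = \sum_k a k ∘ d k.
Proof.
move=> bc1 bc0; rewrite comp_suml; apply: eq_bigr => k _.
rewrite comp_sumr (bigD1 k) //= big1 ?addr0 => [|l lk].
  by rewrite -Defs.compA (Defs.compA (b k)) bc1 comp1m.
by rewrite -Defs.compA (Defs.compA (b k)) bc0 // comp0l comp0r.
Qed.

Lemma local_retract (X Y : E) (i : Mor Y X) (p : Mor X Y) :
  ~ zero_obj X -> p ∘ i = Idm Y -> i ∘ p = Idm X -> local_end Y -> local_end X.
Proof.
move=> nzX pi ip [_ loc]; split=> // f.
have back (g : Mor X X) : iso (p ∘ g ∘ i) -> iso g.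
    have gE : g = i ∘ (p ∘ g ∘ i) ∘ p.
      by rewrite -!Defs.compA ip compm1 Defs.compA ip comp1m.
    move=> h; rewrite gE; apply: iso_comp; last by exists i.
    by apply: iso_comp => //; exists p.
have [/back|h] := loc (p ∘ f ∘ i); [by left | right; apply: back].
by rewrite compBr compBl compm1 pi.
Qed.
End LocalObjects.

(** The first local summand of X is nonzero, so its complement is zero and X is isomorphic to this
    summand. *)
Lemma krull_schmidt_local (K : fieldType) (E : exactCat K) (X : E) :
  krull_schmidt E -> indecomposable X -> local_end X.
Proof.
move=> ks [nzX indX]; have [[|m] [Xs [[inj [prj [pi1 pi0 sumE]]] loc]]] := ks X.
  by case: nzX; rewrite /zero_obj -sumE big_ord0.
have [Y [inj' [prj' [pi1' pi0' sumE']]]] := has_dsum (fun k => Xs (lift ord0 k)).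
pose i2 := \sum_k inj (lift ord0 k) ∘ prj' k.
pose p2 := \sum_k inj' k ∘ prj (lift ord0 k).
have sum1 : inj ord0 ∘ prj ord0 + i2 ∘ p2 = Idm X.
  by rewrite comp_diag // -sumE big_ord_recl.
have d2 : dsum2 (Xs ord0) Y X.
  apply/dsum2P; exists (inj ord0), (prj ord0), i2, p2; split=> //.
  - rewrite (@comp_diag _ _ _ (fun k => Xs (lift ord0 k))) //.
    by move=> k l kl; apply: pi0; rewrite (inj_eq lift_inj).
  - by rewrite comp_sumr big1 // => k _; rewrite Defs.compA pi0 ?comp0l.
  - by rewrite comp_suml big1 // => k _; rewrite -Defs.compA pi0 ?comp0r.
have [z0|zY] := indX _ _ d2; first by case: (loc ord0).
apply: (@local_retract _ _ _ _ (inj ord0) (prj ord0)) (loc ord0) => //.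
rewrite -sum1 -[i2]compm1 (_ : Idm Y = 0) // comp0r comp0l addr0 //.
Qed.

Section RestrictedDimension.
Variables (K : fieldType) (A : pzAlgType K).
Implicit Types M N : lmodType A.

Lemma restr_submod M (N : set M) : is_submod N -> is_submod (N : set (restr M)).
Proof. by move=> [N0 ND NZ]; split=> // k x Nx; rewrite restr_scaleE; apply: NZ. Qed.

Lemma findim_surj M N (g : {linear M -> N}) : (forall z, exists y, g y = z) ->
  findim (restr M) -> findim (restr N).
Proof.
move=> gs [d /(vdim_indep (submodT _))[b [_ sb _]]].
apply: (@vdim_ex _ _ _ _ _ (fun i => g (b i) : restr N)) => //.
move=> z _; have [y <-] := gs z; have [c cE] := sb y I; exists c.
have -> : lcomb c (fun i => g (b i) : restr N) = g (lcomb c b).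
  by rewrite -(lcomb_lin c b (restr_linear g)).
by rewrite /= -linearB cE linear0.
Qed.

(** For e the idempotent of T_j, the dimension of e M is the entry at j of the dimension vector of
    M. *)
Definition act_im M (e : A) : set (restr M) := [set e *: x | x in [set: M]]%classic.

Lemma act_im_submod M (e : A) : is_submod (@act_im M e).
Proof.
split=> [|_ _ [x _ <-] [y _ <-]|k _ [x _ <-]].
- by exists 0 => //; rewrite scaler0.
- by exists (x + y) => //; rewrite scalerDr.
- exists ((algmap k : A) *: x) => //.
  by rewrite restr_scaleE !scalerA algmapC.
Qed.

Lemma act_imP M (e : A) (y : M) : e * e = e -> act_im e (y : restr M) <-> e *: y = y.
Proof.
by move=> ee; split=> [[x _ <-]|ey]; [rewrite scalerA ee | exists y].
Qed.

(** Passing from M to e M is exact for an idempotent e. *)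
Lemma act_im_ses (L M N : lmodType A) (f : {linear L -> M})
    (g : {linear M -> N}) (e : A) a b :
    e * e = e -> mod_ses f g ->
    vdim (@act_im L e) [set 0]%classic a -> vdim (@act_im N e) [set 0]%classic b ->
  vdim (@act_im M e) [set 0]%classic (a + b).
Proof.
move=> ee [finj gs gf]; apply: (vdim_ses (restr_linear f) (restr_linear g));
  try exact: act_im_submod.
- by move=> x _ fx; apply: finj; rewrite fx linear0.
- by move=> _ [x _ <-]; exists (f x) => //; rewrite linearZ_LR.
- by move=> _ [x _ <-]; exists (g x) => //; rewrite linearZ_LR.
- by move=> x _; apply/gf; exists x.
- move=> y /(act_imP _ ee) ey /gf[x xE]; exists x => //; apply/(act_imP _ ee).
  by apply: finj; rewrite linearZ_LR xE.
- move=> z /(act_imP _ ee) ez; have [y yE] := gs z.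
  by exists (e *: y); [exists y | rewrite linearZ_LR yE].
Qed.

End RestrictedDimension.

(** * The simple modules S_j and the dimension vectors of stable modules *)

Section SimpleTops.
Variables (R : realType) (E : frobCat R[i]) (n r : nat) (T : basicCT E n r).
Local Notation Lambda := (Endop (ctT T)).
Local Notation P j := (homod (ctT T) (ctTi T j) : lmodType Lambda).
Hypothesis loc : forall j, local_end (ctTi T j).

Definition idem j : Lambda := ctinj T j ∘ ctprj T j.

Lemma ct_pi1 j : ctprj T j ∘ ctinj T j = Idm _.
Proof. by have [] := ct_dsum T. Qed.

Lemma ct_pi0 j k : j != k -> ctprj T k ∘ ctinj T j = 0.
Proof. by have [_ h _] := ct_dsum T; apply: h. Qed.

Lemma idem_sum : \sum_j idem j = 1 :> Lambda.
Proof. by have [_ _] := ct_dsum T. Qed.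

Lemma idem_idem j : idem j * idem j = idem j.
Proof.
rewrite -[LHS]/(idem j ∘ idem j) /idem -Defs.compA (Defs.compA (ctprj T j)).
by rewrite ct_pi1 comp1m.
Qed.

Lemma prj_generates j (h : P j) : iso ((h : Mor _ _) ∘ ctinj T j) ->
  exists a : Lambda, a *: h = ctprj T j.
Proof.
move=> [u [_ hu]]; exists (ctinj T j ∘ (u ∘ ctprj T j)).
by rewrite homodZE !Defs.compA hu comp1m.
Qed.

(** The elements that do not generate P_j; this turns out to be its only maximal submodule. *)
Definition radP j : set (P j) := [set h | ~ iso ((h : Mor _ _) ∘ ctinj T j)]%classic.

Arguments radP j _ : clear implicits.

Lemma radP_submod j : is_submod (radP j).
Proof.
split=> [|x y Rx Ry|a h Rh].
- rewrite /radP /= comp0l => -[u [u0 _]]; have [nz _] := loc j; case: nz.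
  by rewrite /zero_obj -u0 comp0r.
- by rewrite /radP /= compDl => /(local_add (loc j))[/Rx|/Ry].
(* Inserting the sum of the idempotents between h and a, some summand is invertible by locality.
   Then h inj_k is an isomorphism from T_k to T_j, and k = j because T is basic. *)
rewrite /radP /= homodZE -[(h : Mor _ _) in X in iso X]compm1.
have [_ _ <-] := ct_dsum T; rewrite comp_sumr !comp_suml => /(local_sum (loc j))[k].
rewrite Defs.compA -!Defs.compA Defs.compA => hk.
have hki : iso ((h : Mor _ _) ∘ ctinj T k).
  by apply: iso_factor_local hk => //; case: (loc j).
have jk : k = j by apply: ct_basic; exists ((h : Mor _ _) ∘ ctinj T k).
by move: hki; rewrite jk; exact: Rh.
Qed.

Lemma prj_notin_radP j : ~ radP j (ctprj T j).
Proof. by apply; rewrite ct_pi1; exists (Idm _); rewrite comp1m. Qed.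

(** An element outside [radP] yields [ctprj T j], which generates P_j since x = (inj_j x) prj_j. *)
Lemma proper_sub_radP j (N : submod (P j)) :
  (exists x, ~ smcar N x) -> (N `<=` radP j)%classic.
Proof.
move=> [x Nx] h Nh /prj_generates[a ah]; case: Nx.
have [_ _ NZ] := smP N.
have -> : x = (ctinj T j ∘ (x : Mor _ _) : Lambda) *: (ctprj T j : P j).
  by rewrite homodZE Defs.compA ct_pi1 comp1m.
by apply: (NZ); rewrite -ah; apply: NZ.
Qed.

Lemma radE j h : smcar (Defs.rad (P j)) h <-> radP j h.
Proof.
split=> [Rh|Rh N [pN maxN]].
  apply: (Rh (Submod (radP_submod j))); split.
    by exists (ctprj T j); apply: prj_notin_radP.
  by move=> N' _; apply: proper_sub_radP.
have := maxN (Submod (radP_submod j)); apply=> //; first exact: proper_sub_radP.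
by exists (ctprj T j); apply: prj_notin_radP.
Qed.

Local Notation S j := (quotmod (Defs.rad (P j))).

Definition top_gen j : S j := qpi (Defs.rad (P j)) (ctprj T j).

Lemma top_gen_neq0 j : top_gen j <> 0.
Proof. by move/qpi_eq0/radE/prj_notin_radP. Qed.

Lemma idem_prj j : idem j *: (ctprj T j : P j) = ctprj T j.
Proof. by rewrite homodZE Defs.compA ct_pi1 comp1m. Qed.

Lemma act_im_top0 j k : j != k -> (@act_im _ _ (S j) (idem k) `<=` [set 0])%classic.
Proof.
move=> jk _ [y _ <-]; have [h <-] := qpi_surj y; rewrite -linearZ_LR.
apply/qpi_eq0/radE; rewrite /radP /= homodZE -!Defs.compA ct_pi0 // !comp0r.
by have [h0 _ _] := radP_submod j; move: h0; rewrite /radP /= comp0l.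
Qed.

Section Socle.
Variable M : lmodType Lambda.

Definition cyclic_sub (x : M) : set (restr M) :=
  [set y | exists a : Lambda, y = a *: x]%classic.

Lemma cyclic_is_submod (x : M) : is_submod (cyclic_sub x : set M).
Proof.
split=> [|_ _ [a ->] [b ->]|c _ [a ->]].
- by exists 0; rewrite scale0r.
- by exists (a + b); rewrite scalerDl.
- by exists (c * a); rewrite scalerA.
Qed.

Lemma idem_neq0 (x : M) : x <> 0 -> exists j, idem j *: x <> 0.
Proof.
move=> x0; apply: contrapT => nj; apply: x0.
rewrite -[x]scale1r -idem_sum scaler_suml big1 // => j _.
by apply: contrapT => jx; apply: nj; exists j.
Qed.

Lemma act_linear j (x : M) :
  linear (fun h : P j => (ctinj T j ∘ (h : Mor _ _) : Lambda) *: x).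
Proof.
move=> a f g; rewrite scalerA -scalerDl; congr (_ *: _).
rewrite [LHS]compDr homodZE; congr (_ + _); exact: Defs.compA.
Qed.

(* Take x = e_j x nonzero with Lambda x of least dimension, and h in rad P_j.
   If h x were nonzero then x = a h x for some a, so x would be killed by the
   generator prj_j - a h of P_j; hence h |-> h x factors through S_j. *)
Lemma socle : (exists x : M, x <> 0) -> findim (restr M) ->
  exists j (phi : {linear S j -> M}), injective phi.
Proof.
move=> [x0 x0n] [dM dMP].
pose good d := exists j (x : M), [/\ x <> 0, idem j *: x = x
  & vdim (cyclic_sub x) [set 0]%classic d].
have sc x : is_submod (cyclic_sub x) := restr_submod (cyclic_is_submod x).
have fc x : exists d, vdim (cyclic_sub x) [set 0]%classic d.
  by apply: vdim_sub_ex dMP => //; apply: submod0.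
have [j0 j0n] := idem_neq0 x0n.
have good0 : exists d, `[< good d >].
  have [d dP] := fc (idem j0 *: x0); exists d; apply/asboolP.
  by exists j0, (idem j0 *: x0); split=> //; rewrite scalerA idem_idem.
case: (ex_minnP good0) => d /asboolP[j [x [xn ex dx]]] dmin.
have Rx h : radP j h -> lin_pack (@act_linear j x) h = 0.
  move=> Rh /=; apply: contrapT => /[dup] /idem_neq0[k] + _.
  set y := (ctinj T j ∘ _ : Lambda) *: x; set z := idem k *: y => zn.
  have [d' d'P] := fc z.
  have dd' : (d <= d')%N.
    apply: dmin; apply/asboolP; exists k, z; split=> //.
    by rewrite /z scalerA idem_idem.
  have zx : (cyclic_sub z `<=` cyclic_sub x)%classic.
    move=> _ [a ->]; exists (a * (idem k * (ctinj T j ∘ (h : Mor _ _) : Lambda))).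
    by rewrite /z /y !scalerA !mulrA.
  (* Lambda z is contained in Lambda x and has at least its dimension, so they coincide and x is a
     multiple of z. *)
  have [b bP] : exists b, vdim (cyclic_sub x) (cyclic_sub z) b.
    by apply: vdim_sub_ex dx => // _ ->; case: (sc z).
  have db : d = (d' + b)%N.
    apply: vdim_uniq dx _ => //.
    by apply: vdim_add d'P bP => // _ ->; case: (sc z).
  have b0 : b = 0%N by apply/eqP; rewrite -leqn0 -(leq_add2l d') addn0 -db.
  have [a aE] : cyclic_sub z x.
    by move: bP; rewrite b0 => /vdim0_sub; apply; exists 1; rewrite scale1r.
  pose h' : P j := (a * idem k : Lambda) *: h.
  have [_ RD RZ] := radP_submod j.
  have Rh' : radP j h' by apply: RZ.
  have xh' : lin_pack (@act_linear j x) h' = x.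
    by rewrite linearZ_LR /= -/y -scalerA -aE.
  have xprj : lin_pack (@act_linear j x) (ctprj T j) = x by rewrite /= -[RHS]ex.
  have /prj_generates[c cE] : iso (((ctprj T j : P j) - h' : Mor _ _) ∘ ctinj T j).
    apply: contrapT => Rd; apply: (@prj_notin_radP j).
    by apply: (submod_subr (radP_submod j)) Rh'; exact: Rd.
  apply: xn; rewrite -xprj -cE linearZ_LR.
  have -> : lin_pack (@act_linear j x) ((ctprj T j : P j) - h') = 0.
    by rewrite linearB xprj xh' subrr.
  by rewrite scaler0.
have [|phi phiE] := @quot_lift _ _ (Defs.rad (P j)) _ (lin_pack (@act_linear j x)).
  by move=> h /radE/Rx.
exists j, phi => p q /eqP; rewrite -subr_eq0 -linearB => /eqP.
have [h hE] := qpi_surj (p - q); rewrite -hE phiE => hx.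
apply/eqP; rewrite -subr_eq0 -hE; apply/eqP/qpi_eq0/radE => /prj_generates[a ah].
apply: xn; rewrite -[x]ex -[idem j *: x]/(lin_pack (@act_linear j x) (ctprj T j)).
by rewrite -ah linearZ_LR hx scaler0.
Qed.
End Socle.

Section Decomposition.
Variables (s : 'I_n -> nat) (psi : lmodType Lambda -> int).
Hypothesis findimS : forall j, findim (restr (S j)).
Hypothesis fg : forall W : E, fgen [set: homod (ctT T) W].
Hypothesis sP : forall j, vdim (@act_im _ _ (S j) (idem j)) [set 0]%classic (s j).
Hypothesis psi_ses : forall (L M N : lmodType Lambda)
    (f : {linear L -> M}) (g : {linear M -> N}),
  fgen [set: L] -> fgen [set: N] -> mod_ses f g -> psi M = psi L + psi N.

Local Notation w := (widen_ord (ct_rn T)).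

Lemma idem_proj_act (M : lmodType Lambda) (j : 'I_n) (x : M) :
  stable_mod M -> (r <= j)%N -> idem j *: x = 0.
Proof.
move=> [_ kill] rj; apply: kill; exists (ctTi T j), (ctprj T j), (ctinj T j).
by split=> //; apply/ct_proj.
Qed.

Lemma stable_mod_quot (M : lmodType Lambda) (N : submod M) :
  stable_mod M -> stable_mod (quotmod N).
Proof.
move=> [fM kill]; split; first by apply: fgen_surj fM; apply: qpi_surj.
move=> a x sa; have [y <-] := qpi_surj x.
by rewrite -linearZ_LR kill // linear0.
Qed.

(** Induction on the dimension, splitting off a simple submodule given by [socle]; m j counts the
    copies of S_j, and psi is any function additive on short exact sequences. *)
Lemma stable_decomp d (M : lmodType Lambda) :
    stable_mod M -> vdim [set: restr M]%classic [set 0]%classic d ->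
  exists m : 'I_r -> nat,
    (forall j, vdim (@act_im _ _ M (idem (w j))) [set 0]%classic (m j * s (w j))) /\
    psi M = \sum_j (m j)%:Z * psi (S (w j)).
Proof.
elim/ltn_ind: d M => d IH M stM dM.
have [nz|nnz] := pselect (exists x : M, x <> 0); last first.
  have M0 (x : M) : x = 0 by apply: contrapT => xn; apply: nnz; exists x.
  exists (fun=> 0%N); split=> [j|].
    by rewrite mul0n; apply: vdim0 => [|x _]; [apply: submod0 | apply: M0].
  have ses0 : mod_ses (idfun : {linear M -> M}) (idfun : {linear M -> M}).
    split=> [x y //|z|y]; first by exists z.
    by split=> _; [exists y | apply: M0].
  (* For M = 0 the identity maps form a short exact sequence, so psi M = psi M + psi M. *)
  have /eqP := psi_ses stM.1 stM.1 ses0.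
  rewrite -[X in X == _]addr0 (inj_eq (addrI _)) => /eqP <-.
  by rewrite big1 // => j _; rewrite mul0r.
have [j [phi phi_inj]] := socle nz (ex_intro _ d dM).
pose Q := quotmod (im_submod phi).
have ses : mod_ses phi (qpi (im_submod phi)).
  by split; [exact: phi_inj | exact: qpi_surj | move=> y; exact: qpi_eq0].
have stQ : stable_mod Q := stable_mod_quot (im_submod phi) stM.
have [a aP] := findimS j.
have [b bP] : findim (restr Q) by apply: findim_surj (ex_intro _ d dM); apply: qpi_surj.
have dE : d = (a + b)%N.
  apply: (vdim_uniq _ _ dM) => //.
  have [_ gs gf] := ses.
  apply: (vdim_ses (restr_linear phi) (restr_linear (qpi (im_submod phi)))) aP bP => //.
  - by move=> x _ fx; apply: phi_inj; rewrite fx linear0.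
  - by move=> x _; apply/gf; exists x.
  - by move=> y _ /gf[x xE]; exists x.
  - by move=> z _; have [y yE] := gs z; exists y.
have a0 : (0 < a)%N.
  rewrite lt0n; apply/eqP => a0; move: aP; rewrite a0 => /vdim0_sub/(_ (top_gen j) I).
  exact: top_gen_neq0.
have [|m [mP mpsi]] := IH b _ Q stQ bP.
  by rewrite dE -[X in (X < _)%N]add0n ltn_add2r.
(* For j at least r the idempotent of T_j kills M, yet it fixes the nonzero generator of S_j. *)
have jr : (j < r)%N.
  rewrite ltnNge; apply/negP => rj; apply: (@top_gen_neq0 j); apply: phi_inj.
  rewrite linear0 /top_gen -(idem_prj j) !linearZ_LR.
  exact: idem_proj_act stM rj.
pose j' := Ordinal jr; have wj : w j' = j by apply: val_inj.
exists (fun k => (k == j') + m k)%N; split=> [k|].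
  rewrite mulnDl; apply: act_im_ses ses _ (mP k); first exact: idem_idem.
  case: eqP => [->|/eqP kj]; first by rewrite wj mul1n; apply: sP.
  rewrite mul0n; apply: vdim0; first exact: submod0.
  apply: act_im_top0; apply/eqP => jk; move/eqP: kj; apply; apply: val_inj.
  exact: (congr1 val (esym jk)).
have fS : fgen [set: S j] by apply: fgen_surj (fg (ctTi T j)); apply: qpi_surj.
rewrite (psi_ses fS stQ.1 ses) mpsi -[in LHS]wj.
under [RHS]eq_bigr do rewrite PoszD mulrDl.
rewrite big_split /=; congr (_ + _).
by rewrite (bigD1 j') //= eqxx mul1r big1 ?addr0 // => k /negbTE ->; rewrite mul0r.
Qed.

(** The multiplicities m j are recovered from the dimensions m j * s j, because s j > 0. *)
Lemma stable_mod_dimvec (M M' : lmodType Lambda) (v : 'rV[int]_r) :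
    stable_mod M -> stable_mod M' -> findim (restr M) -> findim (restr M') ->
    dimvec (ctidem T) [set: M] v -> dimvec (ctidem T) [set: M'] v ->
  psi M = psi M'.
Proof.
move=> stM stM' [d dM] [d' dM'] vM vM'.
have [m [mP ->]] := stable_decomp stM dM; have [m' [mP' ->]] := stable_decomp stM' dM'.
apply: eq_bigr => j _; congr (_%:Z * _).
have [e ve eP] := vM j; have [e' ve' eP'] := vM' j.
have ee' : e = e' by apply/eqP; rewrite -eqz_nat -ve -ve'.
have s0 V := @submod0 _ (restr V).
have e1 : e = (m j * s (w j))%N.
  by apply: vdim_uniq eP (mP j); [apply: act_im_submod | apply: s0].
have e2 : e' = (m' j * s (w j))%N.
  by apply: vdim_uniq eP' (mP' j); [apply: act_im_submod | apply: s0].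
apply/eqP; rewrite -(@eqn_pmul2r (s (w j))) -?e1 -?e2 ?ee' //.
rewrite lt0n; apply/eqP => s0'; have := sP (w j); rewrite s0' => /vdim0_sub.
move=> /(_ (top_gen (w j))) H; apply: (@top_gen_neq0 (w j)); apply: H.
by exists (top_gen (w j)) => //; rewrite /top_gen -linearZ_LR idem_prj.
Qed.

End Decomposition.

(** M is spanned by the products of finitely many generators with a basis of the stable endomorphism
    algebra. *)
Lemma stable_mod_findim (M : lmodType Lambda) :
    (exists d, vdim [set: Mor (ctT T) (ctT T)] (@stable0 _ E (ctT T) (ctT T)) d) ->
  stable_mod M -> findim (restr M).
Proof.
move=> [d [b [_ bP]]] [[m [x xP]] kill].
apply: (@vdim_ex_fin _ _ _ _ ('I_m * 'I_d)%type
  (fun ik => (b ik.2 : Lambda) *: x ik.1 : restr M)) => //.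
move=> y _; have : [set: M]%classic y by []; rewrite xP => -[a ->].
have /choice[c cP] : forall i, exists c : 'rV_d, stable0 (a i - \sum_k c 0 k *: b k).
  by move=> i; have [c [? _]] := bP (a i) I; exists c.
exists (fun ik => c ik.1 0 ik.2); apply/eqP; rewrite subr_eq0; apply/eqP.
rewrite -(pair_bigA _ (fun i k => c i 0 k *: ((b k : Lambda) *: x i : restr M))) /=.
apply: eq_bigr => i _.
have /eqP := kill _ (x i) (cP i); rewrite scalerBl subr_eq0 => /eqP ->.
rewrite scaler_suml; apply: eq_bigr => k _.
rewrite [RHS]restr_scaleE scalerA.
have -> : algmap (c i 0 k) * (b k : Lambda) = c i 0 k *: (b k : Mor _ _) :> Mor _ _ by
  rewrite -[LHS]/((b k : Mor _ _) ∘ (c i 0 k *: Idm _)) compZr compm1.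
by [].
Qed.

End SimpleTops.

(** * Laurent monomials and their degrees *)

Section LaurentMonomials.
Variables (R : realType) (n : nat).

Lemma lvar_neq0 (k : 'I_n) : lvar R k != 0.
Proof.
rewrite /lvar tofrac_eq0; apply/eqP => X0.
have := mcoeffX R[i] (mnm1 k) (mnm1 k).
by rewrite X0 mcoeff0 eqxx => /esym/eqP; rewrite oner_eq0.
Qed.

Lemma lmonomD (a b : 'I_n -> int) :
  lmonom R a * lmonom R b = lmonom R (fun k => a k + b k).
Proof.
rewrite /lmonom -big_split; apply: eq_bigr => k _.
by rewrite /= expfzDr // lvar_neq0.
Qed.

Lemma laurent_homog_sum (Ab : zmodType) (g : 'I_n -> Ab) (d : Ab) (V : Type)
    (s : seq V) (a : 'I_n -> int) (c : V -> int) (b : V -> 'I_n -> int) :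
    (forall v, \sum_k g k *~ (a k + b v k) = d) ->
  laurent_homog g d (lmonom R a * \sum_(v <- s) (c v)%:~R * lmonom R (b v)).
Proof.
move=> degv; exists (size s), (fun j => (c (tnth (in_tuple s) j))%:~R).
exists (fun j k => a k + b (tnth (in_tuple s) j) k); split=> //.
rewrite big_tnth mulr_sumr; apply: eq_bigr => j _.
rewrite mulrCA lmonomD; congr (_ * _).
by rewrite !rmorph_int.
Qed.
End LaurentMonomials.

(** * Homogeneity of cluster characters, additivity and mutation of degrees *)

Theorem proposition3p11 (R : realType) (E : frobCat R[i])
    (hE : frobenius_cluster_category E)
    (n r : nat) (T : basicCT E n r)
    (hLambda : noetherian (Endop (ctT T)))
    (hS : forall i : 'I_n, findim (restr (simple_top T i)))
    (Ab : zmodType) (G : K0sum (Endop (ctT T)) Ab) (hG : grading G)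
    (g : 'I_n -> Ab)
    (hGg : K0eq G [seq (FDMod (hS i), g i) | i <- enum 'I_n]) :
  [/\ forall X : E, laurent_homog g (deg G X) (cluster_char T X),
      forall (X Y Z : E) (f : Mor X Y) (h : Mor Y Z),
        confl f h -> deg G Y = deg G X + deg G Z
    & forall (U Uk V : E), cluster_tilting U -> dsum2 Uk V U ->
        indecomposable Uk -> ~ projective Uk ->
        forall (Us M M' : E) (i : Mor Us M) (p : Mor M Uk)
               (i' : Mor Uk M') (p' : Mor M' Us),
          exchange_sequences U i p i' p' ->
          [/\ deg G Us = deg G M - deg G Uk,
              deg G M - deg G Uk = deg G M' - deg G Uk
            & deg G M = deg G M']].
Proof.
have [ks [stHom _] _ gl'] := hE.
have gl := gl' _ (ct_tilting T); have [noeth _] := hLambda.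
have loc j := krull_schmidt_local ks (ct_indec T j).
have fg W : fgen [set: homod (ctT T) W] := homod_fgen (ct_tilting T) (stHom (ctT T) W).
have eulerG (M : lmodType (Endop (ctT T))) : fgen [set: M] ->
    eulerK0 M G = \sum_k g k *~ euler M (simple_top T k).
  (* The function sending N and a to <M, N> a is additive in both, so G may be replaced by the given
     sum over the simple modules. *)
  move=> fM; have := hGg Ab (fun N a => a *~ euler M N); rewrite /eulerK0 => ->.
    by rewrite big_map big_enum.
  split=> [N a b|L N P p q ses a]; first exact: mulrzDl.
  by rewrite (euler_add_r gl noeth fM (fdP L) (fdP P) ses) mulrzDr.
have degD (X Y Z : E) (f : Mor X Y) (h : Mor Y Z) : confl f h ->
    deg G Y = deg G X + deg G Z.
  move=> fh; set C := quotmod (Submod (homod_im_submod (ctT T) h)).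
  have stC : stable_mod C.
    split; first by apply: fgen_surj (fg Z); apply: qpi_surj.
    by move=> a x; apply: (coker_stable fh).
  (* The grading vanishes on C, which supplies the missing fourth term of the exact sequence. *)
  rewrite -[LHS]addr0 -(hG _ stC) /deg /eulerK0 -!big_split /=.
  apply: eq_bigr => x _; rewrite -!mulrzDr; congr (_ *~ _).
  exact: (euler_conflation fh gl noeth fg (fdP x.1)).
split=> //.
- move=> X; have /choice[s sP] : forall j, exists s,
      vdim (act_im (idem T j) : set (restr (simple_top T j))) [set 0]%classic s.
    move=> j; have [d dP] := hS j.
    by apply: vdim_sub_ex dP => //; apply: act_im_submod.
  have dimpair0 v : \sum_k g k *~ dimpair T v k = 0.
    have [[M [stM vM]]|nM] :=
      pselect (exists M, stable_mod M /\ dimvec (ctidem T) [set: M] v).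
      rewrite -[RHS](hG _ stM) (eulerG _ stM.1); apply: eq_bigr => k _; congr (_ *~ _).
      (* The value chosen by [dimpair] is the Euler form of this M, since it is the same for all
         stable modules of dimension vector v. *)
      apply: xget_unique => [|z [M' [stM' vM' ->]]]; first by exists M.
      pose psi (N : lmodType (Endop (ctT T))) := euler N (simple_top T k).
      apply: (@stable_mod_dimvec _ _ _ _ T loc s psi) vM' vM => //.
      + by move=> L N P p q fL fP ses; apply: euler_add_l (hS k) fL fP ses.
      + exact: stable_mod_findim.
      + exact: stable_mod_findim.
    (* No stable module has dimension vector v, so [dimpair] takes its default value 0. *)
    rewrite big1 // => k _; rewrite /dimpair xgetPN ?mulr0z // => z [M [stM vM _]].
    by apply: nM; exists M.
  apply: laurent_homog_sum => v.
  under eq_bigr do rewrite mulrzBr.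
  rewrite sumrB dimpair0 subr0; exact/esym/eulerG/fg.
- move=> U Uk V _ _ _ _ Us M M' p q p' q' [[c1 c2] _ _ _ _].
  have e1 := degD _ _ _ _ _ c1; have e2 := degD _ _ _ _ _ c2.
  (* The two exchange sequences have the same end terms in opposite order. *)
  have e3 : deg G M = deg G M' by rewrite e1 e2 addrC.
  by split=> //; rewrite ?e3 // -e3 e1 addrK.
Qed.
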